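(* Consider the optimization problem $$\min_{X\in\mathbb{R}^{n\times n}}\ \tfrac12\mathrm{Trace}(XAXB)+\mathrm{Trace}(XC)\quad\text{subject to } X\in \mathrm{S}_+(r,n),$$ where $A,B\succ 0$ are of size $n\times n$ and $C\in\mathbb{R}^{n\times n}$ is a symmetric matrix. Consider also the factorization $X=YY^T$ of rank-$r$ symmetric positive semidefinite matrices to encode the rank constraint, where $Y\in\mathbb{R}_*^{n\times r}$. There exists a family of Riemannian metrics $$\begin{aligned} g_x(\xi_x,\eta_x)=\ &\omega\,\langle\eta_x,\ 2AY\,\mathrm{Sym}(Y^TB\xi_x)+2BY\,\mathrm{Sym}(Y^TA\xi_x)+2C\xi_x\rangle\\ &+\langle\eta_x,\ A\xi_xY^TBY+B\xi_xY^TAY\rangle\end{aligned}$$ on $\mathbb{R}_*^{n\times r}$ with $\omega\in[0,1)$, each of which induces a Riemannian metric on $\mathbb{R}_*^{n\times r}/\mathcal{O}(r)$ in the neighborhood of the minimum of the problem. Here $x=Y\in\mathbb{R}_*^{n\times r}$, $\xi_x,\eta_x$ are vectors in the tangent space $\mathbb{R}^{n\times r}$, and the second term of $g_x$ (the one without the factor $\omega$) is the dominant positive definite approximation of the second-order derivative $\mathcal{L}_{xx}(x)$ of the Lagrangian. Beyond the neighborhood, the metric with $\omega=0$ becomes a good metric candidate, as $Y^TBY$ and $Y^TAY$ are positive definite for all $Y\in\mathbb{R}_*^{n\times r}$.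
   Context: $\succ 0$ means symmetric positive definite. $\mathrm{S}_+(r,n)$ is the set of rank-$r$ symmetric positive semidefinite $n\times n$ real matrices; $\mathbb{R}_*^{n\times r}$ is the (open) set of $n\times r$ real matrices of full column rank; $\mathcal{O}(r)$ is the group of $r\times r$ orthogonal matrices. $\langle P,Q\rangle=\mathrm{Trace}(P^TQ)$ is the Euclidean inner product of matrices and $\mathrm{Sym}(D)=(D+D^T)/2$ for a square matrix $D$. Since $\mathbb{R}_*^{n\times r}$ is open in $\mathbb{R}^{n\times r}$, the Lagrangian consists only of the cost, $\mathcal{L}(x)=\tfrac12\mathrm{Trace}(YY^TAYY^TB)+\mathrm{Trace}(YY^TC)$ at $x=Y$. The group $\mathcal{O}(r)$ acts on $\mathbb{R}_*^{n\times r}$ by $Y\mapsto YO$; the points of the quotient are the equivalence classes $[Y]=\{YO:O\in\mathcal{O}(r)\}$, and $YY^T$ is constant on each class. A Riemannian metric $g$ on the total space induces a Riemannian metric on the quotient by $g_{[x]}(\xi_{[x]},\eta_{[x]}):=g_x(\xi_x,\eta_x)$, where $\xi_x,\eta_x$ are the horizontal lifts at $x$ of the tangent vectors $\xi_{[x]},\eta_{[x]}$ to the quotient (their representatives in the $g_x$-orthogonal complement of the tangent space to the class $[x]$), provided that $g_x(\xi_x,\eta_x)$ does not depend on the representative $x$ of $[x]$.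
   Formalization: For ω in (0,1), g is shown to be a Riemannian metric only on an open O(r)-invariant neighborhood (depending on ω) of the minimum, not on all of the full-rank n×r matrices, where it can fail to be positive definite; for ω=0 it is global. *)

(* Defs.v *)
From HB Require Import structures.
From mathcomp Require Import all_boot all_order all_algebra.
From mathcomp Require Import all_classical all_reals all_analysis.

Set Implicit Arguments.
Unset Strict Implicit.
Unset Printing Implicit Defensive.

Import Order.TTheory GRing.Theory Num.Theory.
Import numFieldNormedType.Exports.

Local Open Scope classical_set_scope.
Local Open Scope ring_scope.

Section MatrixNotions.
Context {R : realType}.

Definition frob {m p} (P Q : 'M[R]_(m, p)) : R := \tr (P^T *m Q).

Definition symp {p} (D : 'M[R]_p) : 'M[R]_p := 2^-1 *: (D + D^T).

Definition spd {p} (A : 'M[R]_p) : Prop :=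
  A^T = A /\ forall v : 'cV[R]_p, v != 0 -> 0 < (v^T *m A *m v) 0 0.

Definition spsd {p} (A : 'M[R]_p) : Prop :=
  A^T = A /\ forall v : 'cV[R]_p, 0 <= (v^T *m A *m v) 0 0.

Definition orthogonal_mx {p} : set 'M[R]_p := [set O | O^T *m O = 1%:M].

(* S_+(r, n) *)
Definition psd_rank (r n : nat) : set 'M[R]_n := [set X | spsd X /\ \rank X = r].

(* R_*^{n x r} *)
Definition full_col_rank (n r : nat) : set 'M[R]_(n, r) :=
  [set Y | \rank Y = r].

End MatrixNotions.

Arguments psd_rank {R} r n _.
Arguments full_col_rank {R} n r _.

Section Smoothness.
Context {R : realType} {V : normedModType R}.

(* Every 'M[R]_(m, p) is finite-dimensional, so on an open set this is the
   usual C^k: all the partial derivatives of order at most k exist and are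
   continuous. *)
Fixpoint Ck_on (k : nat) (U : set V) (f : V -> R) : Prop :=
  if k is k'.+1 then
    (forall x, U x -> differentiable f x) /\
    (forall v, Ck_on k' U (fun x => 'D_v f x))
  else forall x, U x -> {for x, continuous f}.

Definition smooth_on (U : set V) (f : V -> R) : Prop := forall k, Ck_on k U f.

Definition second_derivative (f : V -> R) (x xi eta : V) : R :=
  'D_eta (fun y => 'D_xi f y) x.

(* Velocities at x of the curves drawn on S. *)
Definition tangent_to (S : set V) (x : V) : set V :=
  [set v | exists c : R -> V,
    [/\ \forall t \near (0 : R), S (c t), c 0 = x & is_derive (0 : R) 1 c v]].

(* The tangent space of the open set U is identified with V at every point. *)
Definition riemannian_metric_on (U : set V) (g : V -> V -> V -> R) : Prop :=
  [/\ open U,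
      forall x, U x -> forall (a : R) (xi xi' eta : V),
        g x (a *: xi + xi') eta = a * g x xi eta + g x xi' eta,
      forall x, U x -> forall xi eta, g x xi eta = g x eta xi,
      forall x, U x -> forall xi, xi != 0 -> 0 < g x xi xi
    & forall xi eta, smooth_on U (fun x => g x xi eta)].

End Smoothness.

Section Quotient.
Context {R : realType} {n r : nat}.
Local Notation M := 'M[R]_(n, r).
Implicit Types (Y xi eta : M) (W : set (set M)).

Definition orbit_class Y : set M := [set Y *m O | O in orthogonal_mx].

(* R_*^{n x r} / O(r), its points being the classes themselves *)
Definition full_rank_quotient : set (set M) :=
  [set orbit_class Y | Y in full_col_rank n r].

Definition total_over W : set M :=
  full_col_rank n r `&` orbit_class @^-1` W.

Definition open_in_quotient W : Prop :=
  W `<=` full_rank_quotient /\ open (total_over W).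

Definition vertical Y : set M := tangent_to (orbit_class Y) Y.

Definition horizontal (g : M -> M -> M -> R) Y : set M :=
  [set xi | forall v, vertical Y v -> g Y v xi = 0].

(* The tangent vector to the quotient represented by xi at Y, i.e. the image of
   xi under the differential at Y of the projection Y |-> [Y]. It is encoded as
   the set of all its representatives (YO, xi O + v), with v vertical at YO. *)
Definition tangent_class Y xi : set (M * M) :=
  [set p | exists2 O, orthogonal_mx O &
    p.1 = Y *m O /\ vertical p.1 (p.2 - xi *m O)].

Definition quotient_tangent (q : set M) : set (set (M * M)) :=
  [set tau | exists Y xi, q Y /\ tau = tangent_class Y xi].

Definition horizontal_lift (g : M -> M -> M -> R) Y (tau : set (M * M))
    : set M :=
  [set xi | horizontal g Y xi /\ tau (Y, xi)].

(* The linear structure of the tangent space at [Y] is the one for which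
   tangent_class Y is linear. As the projection is a surjective submersion, a
   tensor field on the quotient is smooth iff its pullback is. *)
Definition quotient_riemannian_metric_on W
    (h : set M -> set (M * M) -> set (M * M) -> R) : Prop :=
  let hY Y xi eta := h (orbit_class Y) (tangent_class Y xi)
                                       (tangent_class Y eta) in
  [/\ open_in_quotient W,
      forall Y, total_over W Y -> forall (a : R) xi xi' eta,
        hY Y (a *: xi + xi') eta = a * hY Y xi eta + hY Y xi' eta,
      forall Y, total_over W Y -> forall xi eta, hY Y xi eta = hY Y eta xi,
      forall Y, total_over W Y -> forall xi,
        tangent_class Y xi <> tangent_class Y 0 -> 0 < hY Y xi xi
    & forall xi eta, smooth_on (total_over W) (fun Y => hY Y xi eta)].

(* That h does not mention the representative Y expresses that the value of g
   on horizontal lifts does not depend on it. *)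
Definition induces_quotient_metric W (g : M -> M -> M -> R) : Prop :=
  (forall Y, total_over W Y ->
    forall tau, quotient_tangent (orbit_class Y) tau ->
    exists! xi, horizontal_lift g Y tau xi) /\
  exists h : set M -> set (M * M) -> set (M * M) -> R,
    quotient_riemannian_metric_on W h /\
    forall Y, total_over W Y ->
    forall tau sigma, quotient_tangent (orbit_class Y) tau ->
      quotient_tangent (orbit_class Y) sigma ->
    forall xi eta, horizontal_lift g Y tau xi ->
      horizontal_lift g Y sigma eta ->
    h (orbit_class Y) tau sigma = g Y xi eta.

End Quotient.

Section Problem.
Context {R : realType} {n r : nat}.
Variables A B C : 'M[R]_n.
Implicit Types (X : 'M[R]_n) (Y xi eta : 'M[R]_(n, r)).

Definition cost X : R := 2^-1 * \tr (X *m A *m X *m B) + \tr (X *m C).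

Definition is_minimizer X : Prop :=
  psd_rank r n X /\ forall Z, psd_rank r n Z -> cost X <= cost Z.

Definition lagrangian Y : R :=
  2^-1 * \tr (Y *m Y^T *m A *m Y *m Y^T *m B) + \tr (Y *m Y^T *m C).

(* the term of the metric weighted by omega *)
Definition weighted_form Y xi eta : R :=
  frob eta (2 *: (A *m Y *m symp (Y^T *m B *m xi))
            + 2 *: (B *m Y *m symp (Y^T *m A *m xi))
            + 2 *: (C *m xi)).

Definition dominant_form Y xi eta : R :=
  frob eta (A *m xi *m Y^T *m B *m Y + B *m xi *m Y^T *m A *m Y).

Definition metric (omega : R) Y xi eta : R :=
  omega * weighted_form Y xi eta + dominant_form Y xi eta.

End Problem.

Arguments is_minimizer {R n} r A B C X.

(* Main.v *)
(** The second derivative of the Lagrangian is the sum of the two forms, so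
    g = omega * L_xx + (1 - omega) * dominant. The dominant form is positive
    definite because Y^T A Y and Y^T B Y are. At a minimizer L_xx >= 0, because
    Y |-> Y Y^T maps full-rank matrices into S_+(r, n), hence g is positive
    definite there, and so it is on a saturated open neighborhood: positive
    definiteness is an open condition, by compactness of the sphere, and g is
    O(r)-invariant.

    The vertical space at Y is {Y Om : Om skew-symmetric}. The horizontal part
    of a vector solves a Gram system whose coefficients are polynomial in Y, so
    Cramer's rule shows that it depends smoothly on Y; invariance of g makes
    its value on horizontal lifts independent of the representative. *)

Require Import Defs.
From HB Require Import structures.
From mathcomp Require Import all_boot all_order all_algebra.
From mathcomp Require Import all_classical all_reals all_analysis.
From mathcomp Require Import ring lra.

Set Implicit Arguments.
Unset Strict Implicit.
Unset Printing Implicit Defensive.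

Import Order.TTheory GRing.Theory Num.Theory.
Import numFieldNormedType.Exports.

Local Open Scope classical_set_scope.
Local Open Scope ring_scope.

(** * Smooth functions and matrices *)

Section SmoothFunctions.
Context {R : realType} {V : normedModType R}.
Implicit Types (U : set V) (f g : V -> R).

(** The first-order expansion of [f] at [x] involves only values near [x], so it is also one for
    [g]; uniqueness of the differential then identifies ['d g x] with ['d f x]. *)
Lemma near_eq_differentiable f g x :
  (\near x, f x = g x) -> differentiable f x -> differentiable g x.
Proof.
move=> fg /diff_locallyP[cf ef].
have eg : g \o shift x = cst (g x) + 'd f x +o_ 0 id.
  have fg0 : \forall y \near (0 : V), f (y + x) = g (y + x).
    move: fg; rewrite (near_shift 0 x).
    by apply: filterS => y /=; rewrite subr0.
  apply/eqaddoP => e e0; move/eqaddoP: ef => /(_ e e0) ef.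
  near=> y.
  suff -> : (g \o shift x - (cst (g x) + 'd f x)) y =
            (f \o shift x - (cst (f x) + 'd f x)) y by near: y.
  rewrite !fctE/= (nbhs_singleton fg).
  by congr (_ - _); apply/esym; near: y.
have dg : 'd g x = 'd f x :> (V -> R) by exact: diff_unique.
by apply/diff_locallyP; rewrite dg.
Unshelve. all: by end_near. Qed.

(** As [U] is open, agreement on [U] is agreement near each of its points, which is all that limits
    and derivatives see. *)
Lemma Ck_on_eq k U f g : open U -> (forall x, U x -> f x = g x) ->
  Ck_on k U f -> Ck_on k U g.
Proof.
move=> oU; elim: k f g => [|k IH] f g fg /=.
  move=> cf x Ux; have cfx : f @ x --> f x := cf x Ux.
  suff : g @ x --> g x by [].
  rewrite -(fg x Ux); apply: cvg_trans cfx; apply: near_eq_cvg.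
  by apply: filterS (open_nbhs_nbhs (conj oU Ux)) => y /fg ->.
move=> [df Df].
have nfg x : U x -> \near x, f x = g x.
  by move=> Ux; apply: filterS (open_nbhs_nbhs (conj oU Ux)) => y /fg ->.
split=> [x Ux|v]; first exact: near_eq_differentiable (nfg x Ux) (df x Ux).
apply: IH (Df v) => x Ux; exact/near_eq_derive/nfg.
Qed.

Lemma Ck_on_pred k U f : Ck_on k.+1 U f -> Ck_on k U f.
Proof.
elim: k f => [|k IH] f [df Df].
  by move=> x Ux; exact/differentiable_continuous/df.
by split=> // v; apply: IH.
Qed.

Lemma Ck_on_cst k U (c : R) : Ck_on k U (fun=> c).
Proof.
elim: k c => [|k IH] c; first by move=> x _; exact: cvg_cst.
split=> [x _|v]; first exact: differentiable_cst.
have -> : (fun x => 'D_v (fun=> c) x) = (fun=> 0 : R); last exact: IH.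
by apply/funext => x; rewrite derive_cst.
Qed.

Lemma Ck_onD k U f g : open U ->
  Ck_on k U f -> Ck_on k U g -> Ck_on k U (fun x => f x + g x).
Proof.
move=> oU; elim: k f g => [|k IH] f g.
  by move=> cf cg x Ux; apply: cvgD; [exact: cf|exact: cg].
move=> [df Df] [dg Dg]; split=> [x Ux|v].
  by apply: differentiableD; [exact: df|exact: dg].
apply: Ck_on_eq (IH _ _ (Df v) (Dg v)) => // x Ux /=.
by rewrite [RHS]deriveD//; apply: diff_derivable; [exact: df|exact: dg].
Qed.

Lemma Ck_onM k U f g : open U ->
  Ck_on k U f -> Ck_on k U g -> Ck_on k U (fun x => f x * g x).
Proof.
move=> oU; elim: k f g => [|k IH] f g.
  by move=> cf cg x Ux; apply: cvgM; [exact: cf|exact: cg].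
move=> Cf Cg; have [df Df] := Cf; have [dg Dg] := Cg; split=> [x Ux|v].
  by apply: differentiableM; [exact: df|exact: dg].
apply: (@Ck_on_eq _ _ (fun x => f x * 'D_v g x + g x * 'D_v f x)) => // [x Ux|].
  by rewrite [RHS]deriveM//; apply: diff_derivable; [exact: df|exact: dg].
by apply: Ck_onD => //; apply: IH;
  [exact: Ck_on_pred|exact: Dg|exact: Ck_on_pred|exact: Df].
Qed.

(** The derivative of [1 / f] is [- f' / f ^ 2], so regularity of [1 / f] at order [k] yields order
    [k.+1]. *)
Lemma Ck_onV k U f : open U -> (forall x, U x -> f x != 0) ->
  Ck_on k U f -> Ck_on k U (fun x => (f x)^-1).
Proof.
move=> oU f0; elim: k => [|k IH].
  by move=> cf x Ux; apply: cvgV; [exact: f0|exact: cf].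
move=> Cf; have [df Df] := Cf; split=> [x Ux|v].
  by apply: differentiableV; [exact: df|exact: f0].
apply: (@Ck_on_eq _ _ (fun x => -1 * ((f x)^-1 * (f x)^-1 * 'D_v f x))) =>
  // [x Ux|].
  rewrite (deriveV (f0 x Ux) (diff_derivable (df x Ux))).
  by rewrite mulN1r [RHS]scaleNr expr2 invfM.
have Ci := IH (Ck_on_pred Cf).
exact: Ck_onM oU (Ck_on_cst _ _ _) (Ck_onM oU (Ck_onM oU Ci Ci) (Df v)).
Qed.

Lemma Ck_on_sum (I : Type) (s : seq I) (P : pred I) k U (f : I -> V -> R) :
  open U -> (forall i, P i -> Ck_on k U (f i)) ->
  Ck_on k U (fun x => \sum_(i <- s | P i) f i x).
Proof.
move=> oU Cf; elim: s => [|i s IH].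
  by apply: Ck_on_eq (Ck_on_cst k U 0) => // x _; rewrite big_nil.
have [Pi|Pi] := boolP (P i); last first.
  by apply: Ck_on_eq IH => // x _; rewrite big_cons (negPf Pi).
by apply: Ck_on_eq (Ck_onD oU (Cf i Pi) IH) => // x _; rewrite big_cons Pi.
Qed.

Lemma Ck_on_prod (I : Type) (s : seq I) (P : pred I) k U (f : I -> V -> R) :
  open U -> (forall i, P i -> Ck_on k U (f i)) ->
  Ck_on k U (fun x => \prod_(i <- s | P i) f i x).
Proof.
move=> oU Cf; elim: s => [|i s IH].
  by apply: Ck_on_eq (Ck_on_cst k U 1) => // x _; rewrite big_nil.
have [Pi|Pi] := boolP (P i); last first.
  by apply: Ck_on_eq IH => // x _; rewrite big_cons (negPf Pi).
by apply: Ck_on_eq (Ck_onM oU (Cf i Pi) IH) => // x _; rewrite big_cons Pi.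
Qed.

End SmoothFunctions.

(** * Smoothness of matrix-valued maps, entry by entry *)

Section SmoothMatrices.
Context {R : realType} {V : normedModType R} (U : set V).
Hypothesis oU : open U.

Definition smooth_mx m p (F : V -> 'M[R]_(m, p)) : Prop :=
  forall i j, smooth_on U (fun x => F x i j).

Lemma smooth_mx_eq m p (F G : V -> 'M[R]_(m, p)) :
  (forall x, U x -> F x = G x) -> smooth_mx F -> smooth_mx G.
Proof. by move=> FG sF i j k; apply: Ck_on_eq (sF i j k) => // x /FG ->. Qed.

Lemma smooth_mx_cst m p (M : 'M[R]_(m, p)) : smooth_mx (fun=> M).
Proof. by move=> i j k; exact: Ck_on_cst. Qed.

Lemma smooth_mxD m p (F G : V -> 'M[R]_(m, p)) :
  smooth_mx F -> smooth_mx G -> smooth_mx (fun x => F x + G x).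
Proof.
move=> sF sG i j k; apply: Ck_on_eq (Ck_onD oU (sF i j k) (sG i j k)) => //.
by move=> x _; rewrite mxE.
Qed.

Lemma smooth_mxM m p q (F : V -> 'M[R]_(m, p)) (G : V -> 'M[R]_(p, q)) :
  smooth_mx F -> smooth_mx G -> smooth_mx (fun x => F x *m G x).
Proof.
move=> sF sG i j k.
apply: (@Ck_on_eq _ _ _ _ (fun x => \sum_l F x i l * G x l j)) => //.
  by move=> x _; rewrite mxE.
by apply: Ck_on_sum => // l _; exact: Ck_onM oU (sF i l k) (sG l j k).
Qed.

Lemma smooth_mxT m p (F : V -> 'M[R]_(m, p)) :
  smooth_mx F -> smooth_mx (fun x => (F x)^T).
Proof. by move=> sF i j k; apply: Ck_on_eq (sF j i k) => // x _; rewrite mxE. Qed.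

Lemma smooth_mxZ m p (a : R) (F : V -> 'M[R]_(m, p)) :
  smooth_mx F -> smooth_mx (fun x => a *: F x).
Proof.
move=> sF i j k; apply: Ck_on_eq (Ck_onM oU (Ck_on_cst k U a) (sF i j k)) => //.
by move=> x _; rewrite mxE.
Qed.

Lemma smooth_mxN m p (F : V -> 'M[R]_(m, p)) :
  smooth_mx F -> smooth_mx (fun x => - F x).
Proof.
by move=> /(@smooth_mxZ _ _ (-1)); apply: smooth_mx_eq => x _; rewrite scaleN1r.
Qed.

Lemma smooth_mxtrace m (F : V -> 'M[R]_m) :
  smooth_mx F -> smooth_on U (fun x => \tr (F x)).
Proof. by move=> sF k; apply: Ck_on_sum => // i _; exact: sF. Qed.

Lemma smooth_det m (F : V -> 'M[R]_m) :
  smooth_mx F -> smooth_on U (fun x => \det (F x)).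
Proof.
move=> sF k; apply: Ck_on_sum => // s _; apply: Ck_onM oU (Ck_on_cst _ _ _) _.
by apply: Ck_on_prod => // i _; exact: sF.
Qed.

(** Cramer's rule: each entry of the inverse is a cofactor over a nonvanishing determinant, both
    polynomial in the entries. *)
Lemma smooth_invmx m (F : V -> 'M[R]_m) : (forall x, U x -> F x \in unitmx) ->
  smooth_mx F -> smooth_mx (fun x => invmx (F x)).
Proof.
move=> uF sF i j k.
apply: (@Ck_on_eq _ _ _ _ (fun x => (\det (F x))^-1 * cofactor (F x) j i)) => //.
  by move=> x Ux; rewrite /invmx uF// !mxE.
have dF : Ck_on k U (fun x => (\det (F x))^-1).
  apply: (Ck_onV oU _ (smooth_det sF k)) => x Ux.
  by have := uF x Ux; rewrite unitmxE unitfE.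
apply: (Ck_onM oU dF); apply: Ck_onM oU (Ck_on_cst _ _ _) _.
apply: smooth_det => a b k'.
by apply: Ck_on_eq (sF (lift j a) (lift i b) k') => // x _; rewrite !mxE.
Qed.

Lemma smooth_vec_mx m p (F : V -> 'rV[R]_(m * p)) :
  smooth_mx F -> smooth_mx (fun x => vec_mx (F x)).
Proof.
move=> sF i j k.
by apply: Ck_on_eq (sF 0 (mxvec_index i j) k) => // x _; rewrite mxE.
Qed.

End SmoothMatrices.

Lemma smooth_mx_id (R : realType) m p (U : set 'M[R]_(m, p)) :
  smooth_mx U id.
Proof.
move=> i j [|k]; first by move=> x _; exact: coord_continuous.
split=> [x _|v]; first exact: differentiable_coord.
have -> : (fun x : 'M[R]_(m, p) => 'D_v (fun y : 'M[R]_(m, p) => y i j) x) =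
    (fun=> v i j).
  apply/funext => x.
  by rewrite -[in RHS](derive_id x v) derive_mx ?mxE//; exact: derivable_id.
exact: Ck_on_cst.
Qed.

Lemma smooth_on_continuous (R : realType) (V : normedModType R) (U : set V)
    (f : V -> R) x :
  smooth_on U f -> U x -> {for x, continuous f}.
Proof. by move=> /(_ 0%N); exact. Qed.

Lemma smooth_mx_line (R : realType) m p (U : set R) (M : 'M[R]_(m, p)) :
  open U -> smooth_mx U (fun t : R => t *: M).
Proof.
move=> oU i j k; apply: (@Ck_on_eq _ _ _ _ (fun t : R => t * M i j)) => //.
  by move=> t _; rewrite mxE.
apply: Ck_onM (Ck_on_cst _ _ _) => //; case: k => [|k].
  by move=> t _; exact: cvg_id.
split=> [t _|v]; first exact: (@ex_diff _ _ _ _ _ id id).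
have -> : (fun x : R => 'D_v (fun t : R => t) x) = (fun=> v); last exact: Ck_on_cst.
by apply/funext => x; rewrite derive_id.
Qed.

(** * Positive definite matrices and the Hessian *)

Section PositiveDefinite.
Context {R : realType}.

Lemma spd_congr n m (B : 'M[R]_n) (Y : 'M[R]_(n, m)) :
  (forall v : 'cV_m, Y *m v = 0 -> v = 0) -> spd B -> spd (Y^T *m B *m Y).
Proof.
move=> Yinj [BT Bpos]; split; first by rewrite !trmx_mul trmxK BT mulmxA.
move=> v v0; have Yv0 : Y *m v != 0 by apply: contra_neq v0 => /Yinj.
by have := Bpos _ Yv0; rewrite trmx_mul !mulmxA.
Qed.

Lemma spd_1 m : spd (1%:M : 'M[R]_m).
Proof.
split=> [|w w0]; first exact: trmx1.
rewrite mulmx1 mxE.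
have sq k : w^T 0 k * w k 0 = w k 0 ^+ 2 by rewrite mxE expr2.
under eq_bigr do rewrite sq.
rewrite lt_neqAle sumr_ge0 ?andbT => [|k _]; last exact: sqr_ge0.
rewrite eq_sym; apply: contra_neq w0 => /eqP; rewrite psumr_eq0 => [|k _];
  last exact: sqr_ge0.
move=> /allP w0; apply/matrixP => i j; rewrite ord1 [RHS]mxE; apply/eqP.
by have := w0 i (mem_index_enum i); rewrite sqrf_eq0.
Qed.

(* Cholesky factorization, by induction on the Schur complement. *)
Lemma spd_factor n (B : 'M[R]_n) : spd B -> exists K : 'M[R]_n, B = K *m K^T.
Proof.
elim: n B => [|n IH] B hB; first by exists 0; apply/matrixP => -[].
have [BT Bpos] := hB; pose b := B 0 0.
move: B @b BT Bpos hB; rewrite -[n.+1]/(1 + n)%N => B b BT Bpos hB.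
have defB := submxK B.
have ulb : ulsubmx B = b%:M.
  apply/matrixP => i j; rewrite !ord1 !mxE eqxx mulr1n /b.
  by congr (B _ _); apply/val_inj.
have dlu : (ursubmx B)^T = dlsubmx B by rewrite trmx_ursub BT.
have drT : (drsubmx B)^T = drsubmx B by rewrite trmx_drsub BT.
set u := ursubmx B in dlu defB; set D := drsubmx B in drT defB.
have b_gt0 : 0 < b.
  have e0 : col_mx 1%:M (0 : 'cV[R]_n) != 0.
    apply/eqP => /(congr1 usubmx); rewrite col_mxKu linear0 => /matrixP/(_ 0 0).
    by rewrite !mxE => /eqP; rewrite oner_eq0.
  have := Bpos _ e0; rewrite -defB tr_col_mx mul_row_block mul_row_col.
  by rewrite !trmx0 !mul0mx !mulmx0 !addr0 trmx1 mul1mx mulmx1 ulb mxE eqxx mulr1n.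
have b0 := lt0r_neq0 b_gt0.
have hS : spd (D - b^-1 *: (u^T *m u)).
  split; first by rewrite linearB/= linearZ/= trmx_mul trmxK drT.
  (* For fixed [v], this [w] minimizes the quadratic form over the first coordinate; the minimum is
     the Schur complement evaluated at [v]. *)
  move=> v v0; pose w := - (b^-1 *: (u *m v)).
  have wv0 : col_mx w v != 0.
    by apply: contra_neq v0 => /(congr1 dsubmx); rewrite col_mxKd linear0.
  have := Bpos _ wv0; rewrite -defB tr_col_mx mul_row_block mul_row_col ulb -dlu.
  suff -> : (w^T *m b%:M + v^T *m u^T) *m w + (w^T *m u + v^T *m D) *m v
     = v^T *m (D - b^-1 *: (u^T *m u)) *m v by [].
  have -> : w^T *m b%:M + v^T *m u^T = 0.
    rewrite mul_mx_scalar /w linearN linearZ /= trmx_mul scalerN scalerA mulfV//.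
    by rewrite scale1r addNr.
  rewrite mul0mx add0r; congr (_ *m v).
  rewrite /w linearN linearZ /= trmx_mul mulmxBr -scalemxAr mulNmx -scalemxAl.
  by rewrite mulmxA addrC.
have [K' defS] := IH _ hS.
pose s := Num.sqrt b; have s0 : s != 0 by rewrite lt0r_neq0// sqrtr_gt0.
have ss : s * s = b by rewrite -expr2 sqr_sqrtr// ltW.
(* [s] and [s^-1 *: u^T] reproduce the first row and column of [B]; the term [b^-1 *: (u^T *m u)]
   they add to the lower block is what the Schur complement subtracts. *)
exists (block_mx s%:M 0 (s^-1 *: u^T) K').
rewrite (tr_block_mx s%:M) mulmx_block -defB ulb -dlu.
rewrite !trmx0 !mul0mx !mulmx0 !addr0 tr_scalar_mx linearZ /= trmxK -defS.
congr block_mx.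
- by rewrite -scalar_mxM ss.
- by rewrite mul_scalar_mx scalerA mulfV// scale1r.
- by rewrite mul_mx_scalar scalerA mulfV// scale1r.
- by rewrite -scalemxAl -scalemxAr scalerA -invfM ss addrCA subrr addr0.
Qed.

Lemma trace_congr m n (A : 'M[R]_m) (N : 'M[R]_(m, n)) :
  \tr (N^T *m A *m N) = \sum_j ((col j N)^T *m A *m col j N) 0 0.
Proof.
apply: eq_bigr => j _; rewrite tr_col -row_mul !mxE.
by apply: eq_bigr => k _; rewrite !mxE.
Qed.

Lemma spd_mul0 m n (S : 'M[R]_n) (V : 'M[R]_(n, m)) :
  spd S -> S *m V = 0 -> V = 0.
Proof.
move=> [_ Spos] SV0; apply/matrixP => i j; rewrite [RHS]mxE.
have [cj0|/Spos] := eqVneq (col j V) 0.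
  by move/matrixP: cj0 => /(_ i 0); rewrite !mxE.
by rewrite -mulmxA colE [S *m _]mulmxA SV0 mul0mx mulmx0 mxE ltxx.
Qed.

Lemma spd_unit n (S : 'M[R]_n) : spd S -> S \in unitmx.
Proof.
move=> hS; rewrite -row_free_unit -kermx_eq0 -trmx_eq0; apply/eqP.
apply: (spd_mul0 hS); rewrite -[X in X *m _]hS.1 -trmx_mul mulmx_ker.
by rewrite trmx0.
Qed.

Lemma trace_congr_gt0 m n (A : 'M[R]_m) (N : 'M[R]_(m, n)) :
  spd A -> N != 0 -> 0 < \tr (N^T *m A *m N).
Proof.
move=> [_ Apos] N0; rewrite trace_congr.
have Age0 (v : 'cV_m) : 0 <= (v^T *m A *m v) 0 0.
  by have [->|/Apos/ltW//] := eqVneq v 0; rewrite mulmx0 mxE.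
rewrite lt_neqAle sumr_ge0 ?andbT// eq_sym.
apply: contra_neq N0 => /eqP; rewrite psumr_eq0// => /allP N0.
apply/matrixP => i j; rewrite [RHS]mxE.
have [cj0|/Apos] := eqVneq (col j N) 0.
  by move/matrixP: cj0 => /(_ i 0); rewrite !mxE.
by have /implyP/(_ isT)/eqP-> := N0 j (mem_index_enum j); rewrite ltxx.
Qed.

(** With [S = K K^T], rotating the trace gives [\tr ((N K)^T A (N K))]; moreover [N K = 0] would
    give [N S = 0], hence [N = 0]. *)
Lemma trace_mul_gt0 m n (A : 'M[R]_m) (S : 'M[R]_n) (N : 'M[R]_(m, n)) :
  spd A -> spd S -> N != 0 -> 0 < \tr (N^T *m A *m N *m S).
Proof.
move=> hA hS N0; have [K defS] := spd_factor hS.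
have /(trace_congr_gt0 hA) : N *m K != 0.
  apply: contra_neq N0 => NK0; apply: trmx_inj; rewrite trmx0.
  apply: (spd_mul0 hS); rewrite -[X in X *m _]hS.1 -trmx_mul defS mulmxA NK0.
  by rewrite mul0mx trmx0.
by rewrite trmx_mul defS -!mulmxA mxtrace_mulC !mulmxA.
Qed.

End PositiveDefinite.

(** * Algebraic form of the Hessian of the Lagrangian *)

Section Quadratic.
Context {R : realType} {n r : nat} (A B C : 'M[R]_n).
Hypotheses (AT : A^T = A) (BT : B^T = B) (CT : C^T = C).
Implicit Types (Y xi eta : 'M[R]_(n, r)).

(** The chain rule through [Y Y^T], already carried out: [eta Y^T + Y eta^T] is its first derivative
    along [eta], and [xi eta^T + eta xi^T] its second derivative along [xi] and [eta]. *)
Definition hessian Y xi eta : R :=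
  \tr ((eta *m Y^T + Y *m eta^T) *m A *m (xi *m Y^T + Y *m xi^T) *m B)
  + \tr (Y *m Y^T *m A *m (xi *m eta^T + eta *m xi^T) *m B)
  + \tr ((xi *m eta^T + eta *m xi^T) *m C).

Lemma hessianE Y xi eta :
  weighted_form A B C Y xi eta + dominant_form A B Y xi eta = hessian Y xi eta.
Proof.
rewrite /weighted_form /dominant_form /frob /hessian /symp.
rewrite !trmx_mul !trmxK AT BT -!scalemxAr !scalerA divff ?pnatr_eq0// !scale1r.
(* Transposition where needed, then rotation, brings [eta^T] to the front of each of the eight
   traces of the expanded Hessian. *)
have t1 : \tr (Y *m Y^T *m A *m eta *m xi^T *m B) =
    \tr (eta^T *m A *m Y *m Y^T *m B *m xi).
  rewrite -mxtrace_tr !trmx_mul !trmxK AT BT.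
  by have := mxtrace_mulC (B *m xi) (eta^T *m A *m Y *m Y^T); rewrite !mulmxA.
have t2 : \tr (Y *m eta^T *m A *m Y *m xi^T *m B) =
    \tr (eta^T *m A *m Y *m xi^T *m B *m Y).
  by have := mxtrace_mulC Y (eta^T *m A *m Y *m xi^T *m B); rewrite !mulmxA.
have t3 : \tr (Y *m Y^T *m A *m xi *m eta^T *m B) =
    \tr (eta^T *m B *m Y *m Y^T *m A *m xi).
  by have := mxtrace_mulC (Y *m Y^T *m A *m xi) (eta^T *m B); rewrite !mulmxA.
have t4 : \tr (eta *m Y^T *m A *m xi *m Y^T *m B) =
    \tr (eta^T *m B *m Y *m xi^T *m A *m Y).
  rewrite -mxtrace_tr !trmx_mul !trmxK AT BT.
  by have := mxtrace_mulC (B *m Y *m xi^T *m A *m Y) eta^T; rewrite !mulmxA.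
have t5 : \tr (Y *m eta^T *m A *m xi *m Y^T *m B) =
    \tr (eta^T *m A *m xi *m Y^T *m B *m Y).
  by have := mxtrace_mulC Y (eta^T *m A *m xi *m Y^T *m B); rewrite !mulmxA.
have t6 : \tr (eta *m Y^T *m A *m Y *m xi^T *m B) =
    \tr (eta^T *m B *m xi *m Y^T *m A *m Y).
  rewrite -mxtrace_tr !trmx_mul !trmxK AT BT.
  by have := mxtrace_mulC (B *m xi *m Y^T *m A *m Y) eta^T; rewrite !mulmxA.
have t7 : \tr (xi *m eta^T *m C) = \tr (eta^T *m C *m xi).
  by have := mxtrace_mulC xi (eta^T *m C); rewrite !mulmxA.
have t8 : \tr (eta *m xi^T *m C) = \tr (eta^T *m C *m xi).
  rewrite -mxtrace_tr !trmx_mul !trmxK CT.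
  by have := mxtrace_mulC (C *m xi) eta^T; rewrite !mulmxA.
rewrite !(mulmxDl, mulmxDr) -?scalemxAr !mxtraceD ?mxtraceZ !mulmxA.
rewrite t1 t2 t3 t4 t5 t6 t7 t8; ring.
Qed.

Lemma dominant_sym Y xi eta :
  dominant_form A B Y xi eta = dominant_form A B Y eta xi.
Proof.
rewrite /dominant_form /frob !mulmxDr !mxtraceD.
have sym_swap (P Q : 'M[R]_n) : P^T = P -> Q^T = Q ->
  \tr (eta^T *m (P *m xi *m Y^T *m Q *m Y)) =
  \tr (xi^T *m (P *m eta *m Y^T *m Q *m Y)).
  move=> PT QT; rewrite -mxtrace_tr !trmx_mul !trmxK PT QT !mulmxA.
  by have := mxtrace_mulC (Y^T *m Q *m Y) (xi^T *m P *m eta); rewrite !mulmxA.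
by congr (_ + _); exact: sym_swap.
Qed.


(** Along a line the Lagrangian is a polynomial of degree four in [t], and the symmetric difference
    cancels its odd terms. This exact formula replaces a Taylor expansion in the second-order
    condition at a minimizer. *)
Lemma lagrangian_second_difference Y xi (t : R) :
  lagrangian A B C (Y + t *: xi) + lagrangian A B C (Y - t *: xi)
  = 2 * lagrangian A B C Y + t ^+ 2 * hessian Y xi xi
    + t ^+ 4 * \tr (xi *m xi^T *m A *m xi *m xi^T *m B).
Proof.
pose beta (X Z : 'M[R]_n) := \tr (X *m A *m Z *m B).
have betaDl X X' Z : beta (X + X') Z = beta X Z + beta X' Z.
  by rewrite /beta !mulmxDl mxtraceD.
have betaDr X Z Z' : beta X (Z + Z') = beta X Z + beta X Z'.
  by rewrite /beta mulmxDr mulmxDl mxtraceD.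
have betaZl a X Z : beta (a *: X) Z = a * beta X Z.
  by rewrite /beta -!scalemxAl mxtraceZ.
have betaZr a X Z : beta X (a *: Z) = a * beta X Z.
  by rewrite /beta -scalemxAr -scalemxAl mxtraceZ.
have betaC X Z : X^T = X -> Z^T = Z -> beta X Z = beta Z X.
  move=> XT ZT; rewrite /beta -mxtrace_tr !trmx_mul AT BT XT ZT.
  by rewrite mxtrace_mulC !mulmxA.
have LE Z : lagrangian A B C Z =
    2^-1 * beta (Z *m Z^T) (Z *m Z^T) + \tr (Z *m Z^T *m C).
  by rewrite /lagrangian /beta !mulmxA.
pose X0 := Y *m Y^T; pose X1 := xi *m Y^T + Y *m xi^T; pose X2 := xi *m xi^T.
have HE : hessian Y xi xi = beta X1 X1 + 2 * beta X0 X2 + 2 * \tr (X2 *m C).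
  rewrite /hessian -/X1 -/X0 -/X2 -/(beta X1 X1) -/(beta X0 (X2 + X2)) (betaDr X0).
  by rewrite mulmxDl mxtraceD; ring.
have sq s : (Y + s *: xi) *m (Y + s *: xi)^T = X0 + s *: X1 + (s ^+ 2) *: X2.
  rewrite linearD linearZ /= mulmxDl !mulmxDr -!scalemxAl -!scalemxAr scalerA.
  rewrite expr2 scalerDr !addrA; congr (_ + _).
  by rewrite -!addrA [in RHS](addrC (s *: _)).
have X0T : X0^T = X0 by rewrite trmx_mul trmxK.
have X2T : X2^T = X2 by rewrite trmx_mul trmxK.
have X1T : X1^T = X1 by rewrite linearD /= !trmx_mul !trmxK addrC.
have -> : \tr (xi *m xi^T *m A *m xi *m xi^T *m B) = beta X2 X2.
  by rewrite /beta !mulmxA.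
have LY : lagrangian A B C Y = 2^-1 * beta X0 X0 + \tr (X0 *m C) by exact: LE.
(* With the bodies hidden, bilinearity and symmetry of [beta] and linearity of the trace reduce the
   claim to a polynomial identity. *)
clearbody X0 X1 X2 beta; rewrite -scaleNr LY !LE !sq HE.
rewrite !(betaDl, betaDr, betaZl, betaZr).
rewrite !mulmxDl !mxtraceD -!scalemxAl !mxtraceZ.
rewrite (betaC X2 X0)// (betaC X1 X0)// (betaC X2 X1)//.
by field.
Qed.

End Quadratic.

(** * Derivatives and orbits *)

Section MatrixDerivatives.
Context {R : realType} {V : normedModType R}.

Lemma is_derive_mxP m p (F : V -> 'M[R]_(m, p)) x v (dF : 'M[R]_(m, p)) :
  is_derive x v F dF <->
  forall i j, is_derive x v (fun y => F y i j) (dF i j).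
Proof.
split=> [[Fx <-] i j|dFij].
  apply: DeriveDef; first by move/derivable_mxP: Fx; exact.
  by rewrite derive_mx// mxE.
have Fx : derivable F x v by apply/derivable_mxP => i j; have [] := dFij i j.
apply: DeriveDef => //; rewrite derive_mx//; apply/matrixP => i j; rewrite mxE.
by have [] := dFij i j.
Qed.

Lemma is_derive_mulmx m p q (F : V -> 'M[R]_(m, p)) (G : V -> 'M[R]_(p, q))
    x v dF dG : is_derive x v F dF -> is_derive x v G dG ->
  is_derive x v (fun y => F y *m G y) (dF *m G x + F x *m dG).
Proof.
move=> /is_derive_mxP dFx /is_derive_mxP dGx; apply/is_derive_mxP => i j.
have -> : (fun y => (F y *m G y) i j) =
          \sum_(k < p) ((fun y => F y i k) * (fun y => G y k j)).
  by apply/funext => y; rewrite mxE fct_sumE.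
apply: is_derive_eq; rewrite !mxE -big_split; apply: eq_bigr => k _ /=.
by rewrite addrC; congr (_ + _); rewrite [LHS]mulrC.
Qed.

Lemma is_derive_trmx m p (F : V -> 'M[R]_(m, p)) x v dF :
  is_derive x v F dF -> is_derive x v (fun y => (F y)^T) dF^T.
Proof.
move=> /is_derive_mxP dFx; apply/is_derive_mxP => i j; rewrite mxE.
have -> : (fun y => (F y)^T i j) = (fun y => F y j i); last exact: dFx.
by apply/funext => y; rewrite mxE.
Qed.

Lemma is_derive_mxtrace m (F : V -> 'M[R]_m) x v dF :
  is_derive x v F dF -> is_derive x v (fun y => \tr (F y)) (\tr dF).
Proof.
move=> /is_derive_mxP dFx.
have -> : (fun y => \tr (F y)) = \sum_(k < m) (fun y => F y k k).
  by apply/funext => y; rewrite fct_sumE.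
exact: is_derive_sum.
Qed.

Lemma smooth_mx_derivable m p (F : V -> 'M[R]_(m, p)) x v :
  smooth_mx setT F -> derivable F x v.
Proof.
move=> sF; apply/derivable_mxP => i j; apply: diff_derivable.
by have [dF _] := sF i j 1%N; exact: dF.
Qed.

End MatrixDerivatives.

(** * Orbits of the orthogonal group and their tangent vectors *)

Section OrbitGeometry.
Context {R : realType} {n r : nat}.
Implicit Types (Y xi eta v : 'M[R]_(n, r)) (O Om : 'M[R]_r).

Lemma full_col_rankP Y : reflect (full_col_rank n r Y) (row_full Y).
Proof. exact: eqP. Qed.

(** If [L] is a left inverse of [Y0], then [\det (L Y)] is continuous in [Y] and equals 1 at [Y0];
    wherever it is nonzero, [L Y] has rank [r], and so has [Y]. *)
Lemma full_col_rank_open : open (full_col_rank n r : set 'M[R]_(n, r)).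
Proof.
rewrite openE => Y0 /full_col_rankP fY0.
have cf : {for Y0, continuous (fun Y => \det (pinvmx Y0 *m Y))}.
  apply: (@smooth_on_continuous _ _ setT) => //.
  apply: (smooth_det openT).
  exact (smooth_mxM openT (smooth_mx_cst _ _) (smooth_mx_id _)).
have : \forall Y \near Y0, \det (pinvmx Y0 *m Y) != 0.
  by apply: (cvgr_neq0 _ cf); rewrite mulVpmx// det1 oner_neq0.
apply: filterS => Y; rewrite -unitfE -[_ \is a _]unitmxE -row_full_unit => /eqP fY.
apply/anti_leq/andP; split; first exact: rank_leq_col.
by rewrite -[X in (X <= _)%N]fY mxrankM_maxr.
Qed.

Lemma orthogonal_mx1 : orthogonal_mx (1%:M : 'M[R]_r).
Proof. by rewrite /orthogonal_mx /= trmx1 mul1mx. Qed.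

Lemma orthogonal_mxV O : orthogonal_mx O -> O *m O^T = 1%:M.
Proof. exact: mulmx1C. Qed.

Lemma orthogonal_mxT O : orthogonal_mx O -> orthogonal_mx O^T.
Proof. by rewrite /orthogonal_mx /= trmxK; exact: mulmx1C. Qed.

Lemma orthogonal_mxM O O' :
  orthogonal_mx O -> orthogonal_mx O' -> orthogonal_mx (O *m O').
Proof.
rewrite /orthogonal_mx /= => hO hO'.
by rewrite trmx_mul mulmxA -(mulmxA O'^T) hO mulmx1.
Qed.

Lemma orthogonal_mx_inj Y O : full_col_rank n r Y -> Y = Y *m O -> O = 1%:M.
Proof.
move=> /full_col_rankP/mulVpmx LY /(congr1 (mulmx (pinvmx Y))).
by rewrite mulmxA LY mul1mx.
Qed.

Lemma full_col_rank_orth Y O :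
  orthogonal_mx O -> full_col_rank n r Y -> full_col_rank n r (Y *m O).
Proof.
move=> hO; rewrite /full_col_rank /= mxrankMfree// row_free_unit.
by have /mulmx1_unit[] := hO.
Qed.

Lemma orbit_class_orth Y O :
  orthogonal_mx O -> orbit_class (Y *m O) = orbit_class Y.
Proof.
move=> hO; apply/seteqP; split=> _ [ O' hO' <-].
  by exists (O *m O'); [exact: orthogonal_mxM|rewrite mulmxA].
exists (O^T *m O'); first exact: orthogonal_mxM (orthogonal_mxT hO) hO'.
by rewrite mulmxA -(mulmxA Y) orthogonal_mxV// mulmx1.
Qed.

Lemma orbit_class_refl Y : orbit_class Y Y.
Proof. by exists 1%:M; [exact: orthogonal_mx1|rewrite mulmx1]. Qed.

(** A skew-symmetric matrix does not have the eigenvalue 1: [Om w = w] gives [w^T w = w^T Om w],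
    which equals its own opposite. This makes the Cayley transform well defined. *)
Lemma skew_1B_unit Om : Om^T = - Om -> 1%:M - Om \in unitmx.
Proof.
move=> OmT.
have [_ pos1] := @spd_1 R r.
suff /spd_unit : spd ((1%:M + Om) *m (1%:M - Om)).
  by rewrite unitmx_mul => /andP[].
have -> : (1%:M + Om) *m (1%:M - Om) = (1%:M - Om)^T *m 1%:M *m (1%:M - Om).
  by rewrite [(_ - _)^T]linearB /= trmx1 OmT opprK mulmx1.
apply: spd_congr; last exact: spd_1.
move=> w /eqP; rewrite mulmxBl mul1mx subr_eq0 => /eqP wOm.
apply/eqP/contraT => /pos1; rewrite mulmx1.
have /matrixP/(_ 0 0) : (w^T *m w)^T = - (w^T *m w).
  have -> : w^T *m w = w^T *m (Om *m w) by rewrite -wOm.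
  by rewrite !trmx_mul trmxK OmT mulmxN mulNmx mulmxA.
rewrite [LHS]mxE [RHS]mxE => /eqP.
by rewrite -addr_eq0 -mulr2n mulrn_eq0 => /eqP->; rewrite ltxx.
Qed.

(* The Cayley transform of t Om / 2 is a curve of orthogonal matrices with
   velocity Om at t = 0. *)
Lemma skew_vertical Y Om : Om^T = - Om -> vertical Y (Y *m Om).
Proof.
move=> OmT; pose K (t : R) := t *: (2^-1 *: Om).
have KT t : (K t)^T = - K t by rewrite /K !linearZ /= OmT !scalerN.
have uB t : 1%:M - K t \in unitmx by exact: skew_1B_unit.
have uD t : 1%:M + K t \in unitmx.
  by rewrite -[K t]opprK -KT -unitmx_tr linearB /= trmx1 trmxK uB.
pose Q t := invmx (1%:M - K t) *m (1%:M + K t).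
have QO t : orthogonal_mx (Q t).
  rewrite /orthogonal_mx /= /Q trmx_mul trmx_inv.
  rewrite [(_ - _)^T]linearB [(_ + _)^T]linearD /= trmx1 KT opprK.
  set P := 1%:M - K t; set D := 1%:M + K t.
  have PD : P *m D = D *m P.
    rewrite /P /D [LHS]mulmxBl [RHS]mulmxDl !mul1mx mulmxDr mulmxBr mulmx1.
    by rewrite opprD [LHS]addrA addrK [RHS]addrA addrNK.
  have PDV : P *m invmx D = invmx D *m P.
    rewrite -[LHS]mul1mx -(mulVmx (uD t)) -!mulmxA (mulmxA _ P) -PD.
    by rewrite (mulmxK (uD t)).
  by rewrite PDV -mulmxA (mulKVmx (uB t)) (mulVmx (uD t)).
have K0 : K 0 = 0 by rewrite /K scale0r.
have Q0 : Q 0 = 1%:M by rewrite /Q K0 subr0 addr0 invmx1 mulmx1.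
have sK : smooth_mx setT K by apply: smooth_mx_line; exact: openT.
have dQ : derivable Q 0 1.
  apply: smooth_mx_derivable; have oT := @openT R.
  apply: (smooth_mxM oT); last exact (smooth_mxD oT (smooth_mx_cst _ _) sK).
  apply: (smooth_invmx oT) => [t _|]; first exact: uB.
  exact (smooth_mxD oT (smooth_mx_cst _ _) (smooth_mxN oT sK)).
have dK : is_derive (0 : R) 1 K (2^-1 *: Om).
  apply/is_derive_mxP => i j.
  have -> : (fun t => K t i j) = (2^-1 *: Om) i j \*: (id : R -> R).
    by apply/funext => t; rewrite /K mxE mulrC.
  by apply: is_derive_eq; rewrite [LHS]mulr1.
(* Differentiating [(1 - K) Q = 1 + K] at 0 gives [Q' = 2 K'], hence the factor 1/2 in [K]. *)
have dQ0 : is_derive (0 : R) 1 Q Om.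
  apply: DeriveDef => //; have dQE := derivableP dQ.
  have dc1 := is_derive_cst (1%:M : 'M[R]_r) (0 : R) (1 : R).
  have dBQ := is_derive_mulmx (is_deriveB dc1 dK) dQE.
  have dD := is_deriveD dc1 dK.
  have BQ : (fun t => (cst 1%:M - K) t *m Q t) = cst 1%:M + K.
    by apply/funext => t; rewrite /Q mulmxA [X in X *m _](mulmxV (uB t)) mul1mx.
  rewrite BQ in dBQ; have [_ e1] := dBQ; have [_ e2] := dD.
  have P0 : (cst 1%:M - K) 0 = 1%:M :> 'M[R]_r by rewrite !fctE K0 subr0.
  move: e1; rewrite e2 Q0 P0 mulmx1 mul1mx add0r sub0r => /(canLR (addNKr _)) <-.
  by rewrite -scalerDl -[X in X + X]mul1r -splitr scale1r.
exists (fun t => Y *m Q t); split.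
- by near=> t; exists (Q t).
- by rewrite Q0 mulmx1.
- have := is_derive_mulmx (is_derive_cst Y (0 : R) (1 : R)) dQ0.
  by rewrite mul0mx add0r.
Unshelve. all: by end_near. Qed.

(** Along a curve in the orbit [c c^T] is constant, so [v Y^T + Y v^T = 0]. A left inverse [L] of
    [Y] then gives [v = - Y (L v)^T], and applying [L] once more shows that [L v] is
    skew-symmetric. *)
Lemma vertical_skew Y v : full_col_rank n r Y -> vertical Y v ->
  exists2 Om, Om^T = - Om & v = Y *m Om.
Proof.
move=> /full_col_rankP/mulVpmx LY [c [cS c0 dc]].
have dcc := is_derive_mulmx dc (is_derive_trmx dc).
have : \forall t \near (0 : R), c t *m (c t)^T = Y *m Y^T.
  apply: filterS cS => t [ O hO <-].
  by rewrite trmx_mul mulmxA -(mulmxA Y) orthogonal_mxV// mulmx1.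
move=> /near_eq_is_derive/(_ dcc) [_].
rewrite derive_cst c0 => /esym/eqP; rewrite addr_eq0 => /eqP vY.
pose L := pinvmx Y; have LYT : Y^T *m L^T = 1%:M by rewrite -trmx_mul LY trmx1.
have vE : v = Y *m - (L *m v)^T.
  by rewrite mulmxN trmx_mul mulmxA -mulNmx -vY -mulmxA LYT mulmx1.
exists (- (L *m v)^T) => //.
rewrite linearN /= trmxK; congr (- _).
by rewrite [in LHS]vE mulmxA LY mul1mx.
Qed.

End OrbitGeometry.

(** * The induced metric on the quotient *)

Section GramMatrix.
Context {R : realType} {m p : nat} (b : 'M[R]_(m, p) -> 'M[R]_(m, p) -> R).
Hypothesis bL : forall a X Y Z, b (a *: X + Y) Z = a * b X Z + b Y Z.
Hypothesis bC : forall X Z, b X Z = b Z X.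

Definition gram : 'M[R]_(m * p) :=
  \matrix_(i, j) b (vec_mx (delta_mx 0 i)) (vec_mx (delta_mx 0 j)).

Lemma linear_formE (f : 'M[R]_(m, p) -> R) X :
  (forall a Y Z, f (a *: Y + Z) = a * f Y + f Z) ->
  f X = \sum_i mxvec X 0 i * f (vec_mx (delta_mx 0 i)).
Proof.
move=> fL; have f0 : f 0 = 0.
  by have := fL (-1) 0 0; rewrite scaler0 addr0 mulN1r addNr.
rewrite -[in LHS](mxvecK X) [in LHS](row_sum_delta (mxvec X)) linear_sum /=.
elim: (index_enum _) => [|i s IH]; first by rewrite !big_nil.
by rewrite !big_cons linearZ /= fL IH.
Qed.

Lemma gramE X Z : b X Z = (mxvec X *m gram *m (mxvec Z)^T) 0 0.
Proof.
rewrite (linear_formE (f := b X)) => [|a Y Y']; last by rewrite !(bC X) bL.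
rewrite mxE; apply: eq_bigr => j _; rewrite [_^T _ _]mxE mulrC; congr (_ * _).
rewrite (linear_formE (f := fun Y => b Y _)) => [|a Y Y']; last exact: bL.
by rewrite mxE; apply: eq_bigr => i _; rewrite mxE.
Qed.

Lemma gram_sym : gram^T = gram.
Proof. by apply/matrixP => i j; rewrite !mxE bC. Qed.

(** This transfers to forms two facts about matrices: invertibility, for the horizontal projection,
    and openness of positive definiteness, for the neighborhood of the minimizer. *)
Lemma gram_spd : spd gram <-> forall X, X != 0 -> 0 < b X X.
Proof.
split=> [[_ pos] X X0|pos]; last first.
  split=> [|v v0]; first exact: gram_sym.
  have := pos (vec_mx v^T); rewrite gramE vec_mxK trmxK; apply.
  apply: contra_neq v0 => /(congr1 mxvec); rewrite vec_mxK linear0 => vT0.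
  by apply: trmx_inj; rewrite vT0 trmx0.
rewrite gramE -{1}(trmxK (mxvec X)); apply: pos.
rewrite trmx_eq0; apply: contra_neq X0 => /(congr1 vec_mx).
by rewrite mxvecK linear0.
Qed.

End GramMatrix.

(** * Vertical spaces and tangent vectors to the quotient *)

Section TangentClasses.
Context {R : realType} {n r : nat}.
Implicit Types (Y xi eta v : 'M[R]_(n, r)) (O Om : 'M[R]_r).

Lemma verticalP Y v : full_col_rank n r Y ->
  vertical Y v <-> exists2 Om, Om^T = - Om & v = Y *m Om.
Proof.
by move=> fY; split=> [/vertical_skew|[ Om OmT ->]]; [exact|exact: skew_vertical].
Qed.

Lemma verticalB Y v w : full_col_rank n r Y ->
  vertical Y v -> vertical Y w -> vertical Y (v - w).
Proof.
move=> fY /(verticalP _ fY)[ Om1 T1 ->] /(verticalP _ fY)[ Om2 T2 ->].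
rewrite -mulmxBr; apply: skew_vertical.
by rewrite linearB /= T1 T2 opprB opprK addrC.
Qed.

Lemma vertical0 Y : vertical Y 0.
Proof. by rewrite -(mulmx0 _ Y); apply: skew_vertical; rewrite trmx0 oppr0. Qed.

Lemma vertical_orth Y O v : full_col_rank n r Y -> orthogonal_mx O ->
  vertical Y v -> vertical (Y *m O) (v *m O).
Proof.
move=> fY hO /(verticalP _ fY)[ Om T ->].
have -> : Y *m Om *m O = Y *m O *m (O^T *m Om *m O).
  by rewrite !mulmxA -(mulmxA Y O) orthogonal_mxV// mulmx1.
by apply: skew_vertical; rewrite !trmx_mul trmxK T mulNmx mulmxN mulmxA.
Qed.

(** The action is free on matrices of full column rank: the only [O] that fixes [Y] is the
    identity. *)
Lemma tangent_class_at Y xi xi' : full_col_rank n r Y ->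
  tangent_class Y xi (Y, xi') <-> vertical Y (xi' - xi).
Proof.
move=> fY; split=> [[ O hO /= [/(orthogonal_mx_inj fY) ->]]|vY].
  by rewrite mulmx1.
by exists 1%:M; [exact: orthogonal_mx1|rewrite /= !mulmx1].
Qed.

Lemma tangent_class_eq Y xi xi' : full_col_rank n r Y ->
  vertical Y (xi - xi') -> tangent_class Y xi = tangent_class Y xi'.
Proof.
move=> fY; have sub x x' : vertical Y (x - x') ->
    tangent_class Y x `<=` tangent_class Y x'.
  move=> vx [Y1 x1] [ O hO /= [-> vx1]]; exists O => //; split=> //=.
  have fYO := full_col_rank_orth hO fY.
  have -> : x1 - x' *m O = (x1 - x *m O) - (x' - x) *m O.
    by rewrite mulmxBl opprB addrA addrNK.
  apply: verticalB => //; apply: vertical_orth => //.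
  by rewrite -opprB -sub0r; apply: verticalB => //; exact: vertical0.
move=> vxi; apply/seteqP; split; apply: sub => //.
by rewrite -opprB -sub0r; apply: verticalB => //; exact: vertical0.
Qed.

Lemma tangent_class_orth Y O xi : orthogonal_mx O ->
  tangent_class (Y *m O) (xi *m O) = tangent_class Y xi.
Proof.
move=> hO; apply/seteqP; split=> -[Y1 x1] [ O1 hO1 /= [-> v1]].
  exists (O *m O1); first exact: orthogonal_mxM.
  by rewrite /= !mulmxA.
have OOT : O *m (O^T *m O1) = O1 by rewrite mulmxA orthogonal_mxV// mul1mx.
exists (O^T *m O1); first exact: orthogonal_mxM (orthogonal_mxT hO) hO1.
by rewrite /= -!mulmxA OOT.
Qed.

(** A class represented by [xi'] at [Y O] is represented by [xi' O^T] at [Y]. *)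
Lemma quotient_tangentP Y tau :
  quotient_tangent (orbit_class Y) tau -> exists xi, tau = tangent_class Y xi.
Proof.
move=> [_ [xi' [[ O hO <-] ->]]]; exists (xi' *m O^T).
rewrite -(tangent_class_orth Y (xi' *m O^T) hO) -mulmxA.
by have -> : O^T *m O = 1%:M by []; rewrite mulmx1.
Qed.

Lemma quotient_tangent_class Y xi :
  quotient_tangent (orbit_class Y) (tangent_class Y xi).
Proof. by exists Y, xi; split => //; exact: orbit_class_refl. Qed.

Lemma total_over_orth W Y O : orthogonal_mx O ->
  total_over W Y -> total_over W (Y *m O).
Proof.
move=> hO [fY WY]; split; first exact: full_col_rank_orth.
by rewrite /preimage /= orbit_class_orth.
Qed.

End TangentClasses.

(** * Descent of an invariant metric to the quotient *)

Section InducedMetric.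
Context {R : realType} {n r : nat}.
Local Notation M := 'M[R]_(n, r).
Variables (g : M -> M -> M -> R) (W : set (set M)).
Hypothesis gL : forall Y a xi xi' eta,
  g Y (a *: xi + xi') eta = a * g Y xi eta + g Y xi' eta.
Hypothesis gC : forall Y xi eta, g Y xi eta = g Y eta xi.
Hypothesis gO : forall Y O xi eta, orthogonal_mx O ->
  g (Y *m O) (xi *m O) (eta *m O) = g Y xi eta.
(** The arguments are smooth fields rather than constant vectors because the horizontal parts
    inserted into [g] vary with the base point. *)
Hypothesis g_smooth : forall (U : set M) F G, open U ->
  smooth_mx U F -> smooth_mx U G -> smooth_on U (fun Y => g Y (F Y) (G Y)).
Hypothesis oW : open_in_quotient W.
Hypothesis g_gt0 : forall Y, total_over W Y -> forall xi, xi != 0 -> 0 < g Y xi xi.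

Local Notation U := (total_over W).
Implicit Types (Y xi eta v : M) (Z : 'M[R]_r).

Lemma total_over_metric : riemannian_metric_on U g.
Proof.
split=> [|Y _|Y _|Y UY|xi eta].
- exact: oW.2.
- exact: gL.
- exact: gC.
- exact: g_gt0.
- by apply: g_smooth; [exact: oW.2|exact: smooth_mx_cst|exact: smooth_mx_cst].
Qed.

Let g0l Y eta : g Y 0 eta = 0.
Proof. by have := gL Y (-1) 0 0 eta; rewrite scaler0 addr0 mulN1r addNr. Qed.

Let gBl Y xi xi' eta : g Y (xi - xi') eta = g Y xi eta - g Y xi' eta.
Proof. by rewrite addrC -scaleN1r gL mulN1r addrC. Qed.

(* The symmetric part only serves to make the form definite on the whole of
   'M_r, so that no basis of the skew-symmetric matrices is needed. *)
Definition orbit_form Y Z Z' : R :=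
  g Y (Y *m (Z - Z^T)) (Y *m (Z' - Z'^T)) + \tr ((Z + Z^T)^T *m (Z' + Z'^T)).

Lemma orbit_formL Y a Z Z' Z'' :
  orbit_form Y (a *: Z + Z') Z'' = a * orbit_form Y Z Z'' + orbit_form Y Z' Z''.
Proof.
rewrite /orbit_form.
have -> : Y *m (a *: Z + Z' - (a *: Z + Z')^T) =
    a *: (Y *m (Z - Z^T)) + Y *m (Z' - Z'^T).
  by rewrite [(_ + _)^T]linearP /= opprD addrACA -scalerBr mulmxDr -scalemxAr.
have -> : (a *: Z + Z' + (a *: Z + Z')^T)^T =
    a *: (Z + Z^T)^T + (Z' + Z'^T)^T.
  by rewrite -linearP /=; congr (_^T); rewrite linearP /= addrACA -scalerDr.
by rewrite gL mulmxDl mxtraceD -scalemxAl mxtraceZ; ring.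
Qed.

Lemma orbit_formC Y Z Z' : orbit_form Y Z Z' = orbit_form Y Z' Z.
Proof.
rewrite /orbit_form gC; congr (_ + _).
by rewrite -mxtrace_tr trmx_mul trmxK.
Qed.

(** If [Z] is symmetric, the trace is that of [(2 Z)^T (2 Z)]. Otherwise [Y (Z - Z^T)] is nonzero by
    injectivity of [Y], so the [g] term is positive and the trace is nonnegative. *)
Lemma orbit_form_gt0 Y Z : U Y -> Z != 0 -> 0 < orbit_form Y Z Z.
Proof.
move=> UY Z0; have [fY _] := UY; rewrite /orbit_form.
have [/eqP|ZZ] := eqVneq (Z - Z^T) 0.
  rewrite subr_eq0 => /eqP ZT.
  rewrite -{1}ZT subrr mulmx0 g0l add0r -[X in X *m _]mulmx1.
  apply: trace_congr_gt0; first exact: spd_1.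
  by rewrite -ZT -mulr2n -scaler_nat scaler_eq0 negb_or pnatr_eq0.
apply: ltr_wpDr; last first.
  apply: g_gt0 => //; apply: contra_neq ZZ => /(congr1 (mulmx (pinvmx Y))).
  by rewrite mulmxA mulVpmx ?mul1mx ?mulmx0//; apply/full_col_rankP.
have [->|S0] := eqVneq (Z + Z^T) 0; first by rewrite mulmx0 mxtrace0.
rewrite -[X in X *m _]mulmx1; apply/ltW/trace_congr_gt0 => //; exact: spd_1.
Qed.

Definition orbit_rhs Y xi : 'rV[R]_(r * r) :=
  \row_j g Y xi (Y *m (vec_mx (delta_mx 0 j) - (vec_mx (delta_mx 0 j))^T)).

(** Where [orbit_form Y] is definite, this is the Riesz representative of the linear form with
    coordinates [orbit_rhs Y xi]; the explicit inverse gives access to its smoothness in [Y]. *)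
Definition orbit_coef Y xi : 'M[R]_r :=
  vec_mx (orbit_rhs Y xi *m invmx (gram (orbit_form Y))).

Lemma orbit_coefE Y xi Z : U Y ->
  orbit_form Y (orbit_coef Y xi) Z = g Y xi (Y *m (Z - Z^T)).
Proof.
move=> UY; have oL := orbit_formL Y; have oC := orbit_formC Y.
have /spd_unit uG : spd (gram (orbit_form Y)).
  by apply/(gram_spd oL oC) => Z'; exact: orbit_form_gt0.
rewrite (gramE oL oC) vec_mxK mulmxKV//.
rewrite (linear_formE (f := fun Z => g Y xi (Y *m (Z - Z^T)))) => [|a Z1 Z2].
  by rewrite mxE; apply: eq_bigr => j _; rewrite !mxE mulrC.
rewrite !(gC _ xi) -gL; congr (g _ _ _).
by rewrite [(_ + _)^T]linearP /= opprD addrACA -scalerBr mulmxDr -scalemxAr.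
Qed.

Definition horizontal_part Y xi : M :=
  xi - Y *m (orbit_coef Y xi - (orbit_coef Y xi)^T).

Lemma horizontal_part_vertical Y xi : vertical Y (horizontal_part Y xi - xi).
Proof.
rewrite addrAC subrr add0r -mulmxN; apply: skew_vertical.
by rewrite linearN linearB /= trmxK opprB opprK.
Qed.

Lemma horizontal_part_horizontal Y xi :
  U Y -> horizontal g Y (horizontal_part Y xi).
Proof.
move=> UY; have [fY _] := UY => v /(verticalP _ fY)[ Om OmT ->].
(* For skew [Om], the test matrix [Z = Om / 2] satisfies [Z + Z^T = 0] and [Z - Z^T = Om]: the
   auxiliary trace vanishes and the Gram equation becomes orthogonality to [Y Om]. *)
have := orbit_coefE xi (2^-1 *: Om) UY.
have half : 2^-1 *: Om + 2^-1 *: Om = Om.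
  by rewrite -scalerDl -[X in X + X]mul1r -splitr scale1r.
rewrite /orbit_form [(_ *: _)^T]linearZ /= OmT scalerN subrr opprK half.
rewrite mulmx0 mxtrace0 addr0.
by rewrite /horizontal_part (gC Y (Y *m Om)) gBl => ->; rewrite subrr.
Qed.

Lemma horizontal_vertical_eq0 Y xi :
  U Y -> horizontal g Y xi -> vertical Y xi -> xi = 0.
Proof.
move=> UY hxi /hxi gxi; apply/eqP/contraT => /(g_gt0 UY).
by rewrite gxi ltxx.
Qed.

Lemma horizontalB Y xi eta : horizontal g Y xi -> horizontal g Y eta ->
  horizontal g Y (xi - eta).
Proof. by move=> hxi heta v vY; rewrite gC gBl !(gC _ _ v) hxi// heta// subrr. Qed.

(** The difference of two lifts is both horizontal and vertical, so its [g]-norm vanishes. *)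
Lemma horizontal_lift_unique Y xi eta eta' : U Y ->
  horizontal_lift g Y (tangent_class Y xi) eta ->
  horizontal_lift g Y (tangent_class Y xi) eta' -> eta = eta'.
Proof.
move=> UY; have [fY _] := UY.
move=> [h1 /(tangent_class_at _ _ fY) v1] [h2 /(tangent_class_at _ _ fY) v2].
apply/eqP; rewrite -subr_eq0; apply/eqP; apply: (horizontal_vertical_eq0 UY).
  exact: horizontalB.
have -> : eta - eta' = (eta - xi) - (eta' - xi) by rewrite opprB addrA addrNK.
exact: (verticalB fY v1 v2).
Qed.

Lemma horizontal_part_lift Y xi :
  U Y -> horizontal_lift g Y (tangent_class Y xi) (horizontal_part Y xi).
Proof.
move=> UY; have [fY _] := UY; split; first exact: horizontal_part_horizontal.
by apply/tangent_class_at => //; exact: horizontal_part_vertical.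
Qed.

(** Right multiplication by [O] preserves [g] and carries vertical vectors at [Y] to vertical
    vectors at [Y O]; [O^T] carries them back. *)
Lemma horizontal_lift_orth Y O tau xi : orthogonal_mx O -> U Y ->
  quotient_tangent (orbit_class Y) tau ->
  horizontal_lift g Y tau xi -> horizontal_lift g (Y *m O) tau (xi *m O).
Proof.
move=> hO [fY _] /quotient_tangentP[xi0 ->] [hxi /(tangent_class_at _ _ fY) vxi].
have fYO := full_col_rank_orth hO fY; split.
  move=> v vYO; have hOT := orthogonal_mxT hO.
  have vO : v = v *m O^T *m O by rewrite -mulmxA (hO : O^T *m O = 1%:M) mulmx1.
  rewrite vO gO//; apply: hxi.
  have := vertical_orth fYO hOT vYO.
  by rewrite -mulmxA orthogonal_mxV// mulmx1.
rewrite -(tangent_class_orth Y xi0 hO); apply/tangent_class_at => //.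
by rewrite -mulmxBl; exact: vertical_orth.
Qed.

Lemma horizontal_part_smooth xi : smooth_mx U (fun Y => horizontal_part Y xi).
Proof.
have oU : open U := oW.2.
have sid : smooth_mx U id := smooth_mx_id U.
have scst m p (N : 'M[R]_(m, p)) : smooth_mx U (fun=> N) := smooth_mx_cst U N.
have sY Z : smooth_mx U (fun Y => Y *m Z) := smooth_mxM oU sid (scst _ _ Z).
have sG : smooth_mx U (fun Y => gram (orbit_form Y)).
  move=> i j k; set Ei := vec_mx (delta_mx 0 i) : 'M[R]_r.
  set Ej := vec_mx (delta_mx 0 j) : 'M[R]_r.
  apply: (@Ck_on_eq _ _ _ _ (fun Y => orbit_form Y Ei Ej)) => // [Y _|].
    by rewrite mxE.
  exact: (Ck_onD oU (g_smooth oU (sY _) (sY _) k) (Ck_on_cst k U _)).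
have sr : smooth_mx U (fun Y => orbit_rhs Y xi).
  move=> i j k; set Ej := vec_mx (delta_mx 0 j) : 'M[R]_r.
  apply: (@Ck_on_eq _ _ _ _ (fun Y => g Y xi (Y *m (Ej - Ej^T)))) => // [Y _|].
    by rewrite mxE.
  exact: (g_smooth oU (scst _ _ xi) (sY _) k).
have sc : smooth_mx U (fun Y => orbit_coef Y xi).
  apply: (smooth_vec_mx oU); apply: (smooth_mxM oU sr).
  apply: (smooth_invmx oU) sG => Y UY; apply: spd_unit.
  by apply/(gram_spd (orbit_formL Y) (orbit_formC Y)) => Z; exact: orbit_form_gt0.
apply: (smooth_mxD oU (scst _ _ xi)); apply: (smooth_mxN oU).
apply: (smooth_mxM oU sid); apply: (smooth_mxD oU sc).
exact: (smooth_mxN oU (smooth_mxT oU sc)).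
Qed.

(** The value is chosen among those given by all representatives and lifts, with default 0 if there
    are none; [quotient_metricE] shows that over [W] only one value occurs. *)
Definition quotient_metric (q : set M) (tau sigma : set (M * M)) : R :=
  xget 0 [set c | exists Y xi eta,
    [/\ q Y, horizontal_lift g Y tau xi, horizontal_lift g Y sigma eta
      & c = g Y xi eta]].

Lemma quotient_metricE Y tau sigma xi eta : U Y ->
  quotient_tangent (orbit_class Y) tau -> quotient_tangent (orbit_class Y) sigma ->
  horizontal_lift g Y tau xi -> horizontal_lift g Y sigma eta ->
  quotient_metric (orbit_class Y) tau sigma = g Y xi eta.
Proof.
move=> UY qtau qsigma hxi heta; apply: xget_unique.
  by exists Y, xi, eta; split=> //; exact: orbit_class_refl.
move=> _ [_ [xi1 [eta1 [[ O hO <-] hxi1 heta1 ->]]]].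
(* By uniqueness, the lift at another representative [Y O] is the translate of the lift at [Y];
   invariance of [g] then makes the two values equal. *)
have uniq_lift t x x1 : quotient_tangent (orbit_class Y) t ->
    horizontal_lift g Y t x -> horizontal_lift g (Y *m O) t x1 -> x1 = x *m O.
  move=> qt hx hx1; have := horizontal_lift_orth hO UY qt hx.
  move: hx1; rewrite -(orbit_class_orth Y hO) in qt.
  have [x0 ->] := quotient_tangentP qt.
  exact: horizontal_lift_unique (total_over_orth hO UY).
by rewrite (uniq_lift _ _ _ qtau hxi hxi1) (uniq_lift _ _ _ qsigma heta heta1) gO.
Qed.

Lemma quotient_metric_induced : induces_quotient_metric W g.
Proof.
split.
  move=> Y UY tau /quotient_tangentP[xi ->]; exists (horizontal_part Y xi).
  split; first exact: horizontal_part_lift.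
  by move=> eta; exact/horizontal_lift_unique/horizontal_part_lift.
exists quotient_metric; split; last first.
  by move=> Y UY tau sigma *; exact: quotient_metricE.
have hE Y xi eta : U Y -> quotient_metric (orbit_class Y) (tangent_class Y xi)
    (tangent_class Y eta) = g Y (horizontal_part Y xi) (horizontal_part Y eta).
  move=> UY; apply: quotient_metricE => //;
  by [exact: quotient_tangent_class|exact: horizontal_part_lift].
have hpart Y xi eta : U Y -> horizontal g Y eta -> vertical Y (eta - xi) ->
    horizontal_part Y xi = eta.
  move=> UY heta veta; have [fY _] := UY.
  apply: (horizontal_lift_unique UY) (horizontal_part_lift xi UY) _.
  by split=> //; apply/tangent_class_at.
split=> //.
(* Linearity of the horizontal part follows from its uniqueness: the combination of the parts is
   horizontal and differs from the combination of the vectors by a vertical one. *)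
- move=> Y UY a xi xi' eta; have [fY _] := UY; rewrite !hE// -gL; congr (g _ _ _).
  set P := horizontal_part Y; apply: hpart => //.
    move=> v vY; rewrite gC gL !(gC _ _ v).
    by rewrite !(horizontal_part_horizontal _ UY vY) mulr0 addr0.
  have /(verticalP _ fY)[ Om OmT e1] := horizontal_part_vertical Y xi.
  have /(verticalP _ fY)[ Om' OmT' e2] := horizontal_part_vertical Y xi'.
  rewrite opprD addrACA -scalerBr e1 e2 scalemxAr -mulmxDr; apply: skew_vertical.
  by rewrite linearD linearZ /= OmT OmT' scalerN opprD.
- by move=> Y UY xi eta; rewrite !hE// gC.
(* A vector whose horizontal part is zero is vertical, so it represents the zero tangent vector. *)
- move=> Y UY xi; have [fY _] := UY; rewrite hE// => xi_neq0; apply: g_gt0 => //.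
  apply: contra_not_neq xi_neq0 => P0; apply: tangent_class_eq => //.
  rewrite subr0 -[xi]opprK -sub0r; apply: verticalB => //; first exact: vertical0.
  by have := horizontal_part_vertical Y xi; rewrite P0 sub0r.
- move=> xi eta k; have oU : open U := oW.2.
  apply: Ck_on_eq (g_smooth oU (horizontal_part_smooth xi)
    (horizontal_part_smooth eta) k) => //.
  by move=> Y UY; rewrite hE.
Qed.

End InducedMetric.

(** * The metrics of the theorem *)

(** The form is jointly continuous in the vector and in [x], so compactness of the unit sphere gives
    one neighborhood of [x0] on which it is positive at every unit vector; homogeneity of degree two
    reaches the other nonzero vectors. *)
Lemma near_spd (R : realType) (V : normedModType R) N (G : V -> 'M[R]_N) x0 :
  (forall i j, {for x0, continuous (fun x => G x i j)}) ->
  (forall x, (G x)^T = G x) -> spd (G x0) -> \forall x \near x0, spd (G x).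
Proof.
move=> cG GT [_ pos0].
pose K : set 'rV[R]_N := [set z | `|z| = 1].
have cK : compact K.
  apply: bounded_closed_compact.
    by exists 1; split => // y y1 z /= ->; exact: ltW.
  have -> : K = (fun z : 'rV[R]_N => `|z|) @^-1` [set 1] by [].
  by apply: closed_comp; [move=> z _; exact: norm_continuous|exact: closed_eq].
have qcvg (z : 'rV[R]_N) : (p.1 *m G p.2 *m p.1^T) 0 0 @[p --> (z, x0)] -->
    (z *m G x0 *m z^T) 0 0.
  have zcvg i : (p.1 : 'rV[R]_N) 0 i @[p --> (z, x0)] --> z 0 i.
    by apply: (@cvg_comp _ _ _ _ (fun y : 'rV[R]_N => y 0 i));
      [exact: cvg_fst|exact: coord_continuous].
  have Gcvg i j : G (p : 'rV[R]_N * V).2 i j @[p --> (z, x0)] --> G x0 i j.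
    by apply: (@cvg_comp _ _ _ _ (fun y => G y i j)); [exact: cvg_snd|exact: cG].
  have addc : continuous (fun x : R * R => x.1 + x.2) := @add_continuous R.
  have -> : (fun p : 'rV[R]_N * V => (p.1 *m G p.2 *m p.1^T) 0 0) =
      (fun p => \sum_j (\sum_i p.1 0 i * G p.2 i j) * p.1 0 j).
    by apply/funext => p; rewrite mxE; apply: eq_bigr => j _; rewrite !mxE.
  have -> : (z *m G x0 *m z^T) 0 0 = \sum_j (\sum_i z 0 i * G x0 i j) * z 0 j.
    by rewrite mxE; apply: eq_bigr => j _; rewrite !mxE.
  apply: (cvg_big addc) => j _; apply: cvgM; last exact: zcvg.
  by apply: (cvg_big addc) => i _; apply: cvgM; [exact: zcvg|exact: Gcvg].
have /compact_near_coveringP cvK := cK.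
have : \forall x \near x0, K `<=` (fun z => 0 < (z *m G x *m z^T) 0 0).
  apply: (cvK _ (nbhs x0) (fun x z => 0 < (z *m G x *m z^T) 0 0)) => z Kz.
  have z0 : z != 0.
    by rewrite -normr_eq0; have -> : `|z| = 1 by []; rewrite oner_eq0.
  have := pos0 z^T; rewrite trmxK trmx_eq0 => /(_ z0) qz.
  exact: cvgr_gt (qcvg z) _ qz.
apply: filterS => x Kpos; split=> // v v0.
have nv0 : 0 < `|v^T| by rewrite normr_gt0 trmx_eq0.
have /Kpos : K (`|v^T|^-1 *: v^T).
  by rewrite /K /= normrZ gtr0_norm ?invr_gt0// mulVf// gt_eqF.
rewrite [(_ *: _)^T]linearZ /= trmxK -!scalemxAl -scalemxAr scalerA mxE.
by rewrite pmulr_rgt0// mulr_gt0 ?invr_gt0.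
Qed.

(** * Bilinearity, invariance, smoothness and positivity of the metrics *)

Section MetricProperties.
Context {R : realType} {n r : nat} (A B C : 'M[R]_n).
Hypotheses (hA : spd A) (hB : spd B) (CT : C^T = C).
Implicit Types (Y xi eta : 'M[R]_(n, r)) (O : 'M[R]_r).

Let AT : A^T = A := hA.1.
Let BT : B^T = B := hB.1.

(** In this form [Y], [xi] and [eta] enter only through products [P Q^T], as in [hessian]; such
    products do not change when both factors are multiplied on the right by the same orthogonal
    matrix. *)
Lemma dominantE Y xi eta : dominant_form A B Y xi eta =
  \tr (Y *m eta^T *m A *m (xi *m Y^T) *m B)
  + \tr (Y *m eta^T *m B *m (xi *m Y^T) *m A).
Proof.
rewrite /dominant_form /frob mulmxDr mxtraceD; congr (_ + _).
  have := mxtrace_mulC (eta^T *m A *m (xi *m Y^T) *m B) Y.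
  by rewrite !mulmxA.
have := mxtrace_mulC (eta^T *m B *m (xi *m Y^T) *m A) Y.
by rewrite !mulmxA.
Qed.

(** Both terms have the shape [\tr (xi^T P xi S)] with [S = Y^T Q Y], positive definite because [Y]
    is injective. *)
Lemma dominant_gt0 Y xi : full_col_rank n r Y -> xi != 0 ->
  0 < dominant_form A B Y xi xi.
Proof.
move=> /full_col_rankP/mulVpmx LY xi0.
have Yinj (v : 'cV_r) : Y *m v = 0 -> v = 0.
  by move=> /(congr1 (mulmx (pinvmx Y))); rewrite mulmxA LY mul1mx mulmx0.
rewrite /dominant_form /frob mulmxDr mxtraceD.
have pos (P Q : 'M[R]_n) : spd P -> spd Q ->
    0 < \tr (xi^T *m (P *m xi *m Y^T *m Q *m Y)).
  move=> hP hQ; have := trace_mul_gt0 hP (spd_congr Yinj hQ) xi0.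
  by rewrite !mulmxA.
by rewrite addr_gt0// pos.
Qed.

Lemma metricE omega Y xi eta : metric A B C omega Y xi eta =
  omega * hessian A B C Y xi eta + (1 - omega) * dominant_form A B Y xi eta.
Proof. by rewrite -(hessianE AT BT CT) /metric; ring. Qed.

Lemma metricL omega Y a xi xi' eta :
  metric A B C omega Y (a *: xi + xi') eta =
  a * metric A B C omega Y xi eta + metric A B C omega Y xi' eta.
Proof.
rewrite !metricE !dominantE /hessian !linearP /=.
rewrite !(mulmxDl, mulmxDr) -?scalemxAl -?scalemxAr.
rewrite -?scalemxAl -?scalemxAr -?scalemxAl !mxtraceD !mxtraceZ.
by ring.
Qed.

Lemma hessianC Y xi eta : hessian A B C Y xi eta = hessian A B C Y eta xi.
Proof.
rewrite /hessian (addrC (eta *m xi^T)); congr (_ + _ + _).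
set X := eta *m Y^T + _; set Z := xi *m Y^T + _.
have XT : X^T = X by rewrite /X linearD /= !trmx_mul !trmxK addrC.
have ZT : Z^T = Z by rewrite /Z linearD /= !trmx_mul !trmxK addrC.
rewrite -mxtrace_tr !trmx_mul AT BT XT ZT.
by rewrite mxtrace_mulC !mulmxA.
Qed.

Lemma metricC omega Y xi eta :
  metric A B C omega Y xi eta = metric A B C omega Y eta xi.
Proof. by rewrite !metricE hessianC (dominant_sym AT BT). Qed.

Lemma metric_orth omega Y O xi eta : orthogonal_mx O ->
  metric A B C omega (Y *m O) (xi *m O) (eta *m O) = metric A B C omega Y xi eta.
Proof.
move=> /orthogonal_mxV OOT.
have cancelO (P Q : 'M[R]_(n, r)) : P *m O *m (Q *m O)^T = P *m Q^T.
  by rewrite trmx_mul mulmxA -(mulmxA P) OOT mulmx1.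
by rewrite !metricE !dominantE /hessian !cancelO.
Qed.

Lemma metric_smooth omega (U : set 'M[R]_(n, r)) F G : open U ->
  smooth_mx U F -> smooth_mx U G ->
  smooth_on U (fun Y => metric A B C omega Y (F Y) (G Y)).
Proof.
move=> oU sF sG k.
have sid : smooth_mx U id := smooth_mx_id U.
have st (P Q : 'M[R]_(n, r) -> 'M[R]_(n, r)) : smooth_mx U P -> smooth_mx U Q ->
    smooth_mx U (fun Y => P Y *m (Q Y)^T).
  by move=> sP sQ; exact (smooth_mxM oU sP (smooth_mxT oU sQ)).
have sc (P : 'M[R]_(n, r) -> 'M[R]_n) (D : 'M[R]_n) : smooth_mx U P ->
    smooth_mx U (fun Y => P Y *m D).
  by move=> sP; exact (smooth_mxM oU sP (smooth_mx_cst U D)).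
have str (P Q : 'M[R]_(n, r) -> 'M[R]_n) D E : smooth_mx U P -> smooth_mx U Q ->
    Ck_on k U (fun Y => \tr (P Y *m D *m Q Y *m E)).
  move=> sP sQ.
  exact (smooth_mxtrace oU (sc _ E (smooth_mxM oU (sc _ D sP) sQ)) k).
apply: (@Ck_on_eq _ _ _ _ (fun Y => omega * hessian A B C Y (F Y) (G Y) +
  (1 - omega) * (\tr (Y *m (G Y)^T *m A *m (F Y *m Y^T) *m B)
  + \tr (Y *m (G Y)^T *m B *m (F Y *m Y^T) *m A)))) => // [Y _|].
  by rewrite metricE dominantE.
have sFY := st _ _ sF sid; have sYF := st _ _ sid sF.
have sGY := st _ _ sG sid; have sYG := st _ _ sid sG.
have sFG := smooth_mxD oU (st _ _ sF sG) (st _ _ sG sF).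
apply: (Ck_onD oU).
  apply: (Ck_onM oU (Ck_on_cst _ _ _)); apply: (Ck_onD oU).
    apply: (Ck_onD oU).
      exact (str _ _ A B (smooth_mxD oU sGY sYG) (smooth_mxD oU sFY sYF)).
    exact (str _ _ A B (st _ _ sid sid) sFG).
  exact (smooth_mxtrace oU (sc _ C sFG) k).
apply: (Ck_onM oU (Ck_on_cst _ _ _)); apply: (Ck_onD oU).
  exact (str _ _ A B sYG sFY).
exact (str _ _ B A sYG sFY).
Qed.

Let is_derive_const (m p : nat) (D : 'M[R]_(m, p)) Y xi :
  is_derive Y xi (fun=> D) 0 := is_derive_cst D Y xi.

Let is_derive_gram Y xi :
  is_derive Y xi (fun y => y *m y^T) (xi *m Y^T + Y *m xi^T) :=
  is_derive_mulmx (is_derive_id Y xi) (is_derive_trmx (is_derive_id Y xi)).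

Lemma lagrangian_derive Y xi : is_derive Y xi (lagrangian A B C)
  (\tr (Y *m Y^T *m A *m (xi *m Y^T + Y *m xi^T) *m B)
   + \tr ((xi *m Y^T + Y *m xi^T) *m C)).
Proof.
have dX := is_derive_gram Y xi; have dc m p D := @is_derive_const m p D Y xi.
have d1 := is_derive_mxtrace (is_derive_mulmx
  (is_derive_mulmx (is_derive_mulmx dX (dc _ _ A)) dX) (dc _ _ B)).
have d2 := is_derive_mxtrace (is_derive_mulmx dX (dc _ _ C)).
have d3 := is_deriveD (is_deriveZ 2^-1 d1) d2.
have -> : lagrangian A B C = 2^-1 \*:
    (fun y : 'M[R]_(n, r) => \tr (y *m y^T *m A *m (y *m y^T) *m B))
    + (fun y => \tr (y *m y^T *m C)).
  by apply/funext => y; rewrite /lagrangian !fctE /= !mulmxA.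
apply: is_derive_eq d3 _; rewrite !mulmx0 !addr0; congr (_ + _).
set X := Y *m Y^T; set X1 := xi *m Y^T + _.
have XT : X^T = X by rewrite trmx_mul trmxK.
have X1T : X1^T = X1 by rewrite /X1 linearD /= !trmx_mul !trmxK addrC.
(* The two terms of the product rule agree by transposition, which absorbs the factor 1/2. *)
clearbody X X1; have eq01 : \tr (X1 *m A *m X *m B) = \tr (X *m A *m X1 *m B).
  rewrite -mxtrace_tr !trmx_mul AT BT XT X1T.
  by rewrite mxtrace_mulC !mulmxA.
rewrite mulmxDl mxtraceD eq01 scalerDr -scalerDl.
by rewrite -[X in X + X]mul1r -splitr scale1r.
Qed.

Lemma lagrangian_second_derivative Y xi eta :
  second_derivative (lagrangian A B C) Y xi eta = hessian A B C Y xi eta.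
Proof.
have -> : second_derivative (lagrangian A B C) Y xi eta = 'D_eta
    ((fun y => \tr (y *m y^T *m A *m (xi *m y^T + y *m xi^T) *m B))
     + (fun y => \tr ((xi *m y^T + y *m xi^T) *m C))) Y.
  rewrite /second_derivative; congr ('D_eta _ Y); apply/funext => y.
  by have [_ ->] := lagrangian_derive y xi.
have dX := is_derive_gram Y eta; have dc m p D := @is_derive_const m p D Y eta.
have did := is_derive_id Y eta.
have d0 := is_deriveD (is_derive_mulmx (dc _ _ xi) (is_derive_trmx did))
  (is_derive_mulmx did (dc _ _ xi^T)).
have d1 := is_derive_mxtrace (is_derive_mulmx
  (is_derive_mulmx (is_derive_mulmx dX (dc _ _ A)) d0) (dc _ _ B)).
have d2 := is_derive_mxtrace (is_derive_mulmx d0 (dc _ _ C)).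
have [_ ->] := is_deriveD d1 d2.
by rewrite !mulmx0 !mul0mx !addr0 !add0r mulmxDl mxtraceD.
Qed.

Lemma psd_rank_gram Y : full_col_rank n r Y -> psd_rank r n (Y *m Y^T).
Proof.
move=> /full_col_rankP fY; have LY := mulVpmx fY.
split.
  split=> [|v]; first by rewrite trmx_mul trmxK.
  have -> : v^T *m (Y *m Y^T) *m v = (Y^T *m v)^T *m (Y^T *m v).
    by rewrite trmx_mul trmxK !mulmxA.
  by rewrite mxE sumr_ge0// => i _; rewrite mxE -expr2 sqr_ge0.
rewrite mxrankMfree; first exact/eqP.
by rewrite /row_free mxrank_tr.
Qed.

Lemma cost_gram Y : cost A B C (Y *m Y^T) = lagrangian A B C Y.
Proof. by rewrite /cost /lagrangian !mulmxA. Qed.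

(** For small [t], [Y + t xi] and [Y - t xi] still have full rank, so both compete with [Y]; a
    negative Hessian would make their second difference [t ^ 2 (H + t ^ 2 c)] negative. *)
Lemma hessian_ge0 Y xi : full_col_rank n r Y ->
  is_minimizer r A B C (Y *m Y^T) -> 0 <= hessian A B C Y xi xi.
Proof.
move=> fY [_ minY]; rewrite leNgt; apply/negP => H_lt0.
pose c := \tr (xi *m xi^T *m A *m xi *m xi^T *m B).
(* The sign [s] will be 1 and -1, to treat both directions at once. *)
have line s : Y + t *: (s *: xi) @[t --> (0 : R)] --> Y.
  rewrite -[X in _ --> X]addr0 -(scale0r (s *: xi)).
  by apply: cvgD; [exact: cvg_cst|apply: cvgZr_tmp; exact: cvg_id].
have nf s : \forall t \near (0 : R), full_col_rank n r (Y + t *: (s *: xi)).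
  apply: (line s); apply: open_nbhs_nbhs; split=> //; exact: full_col_rank_open.
have nneg : \forall t \near (0 : R), hessian A B C Y xi xi + t ^+ 2 * c < 0.
  have cv : hessian A B C Y xi xi + t ^+ 2 * c @[t --> (0 : R)] -->
      hessian A B C Y xi xi + 0 * 0 * c.
    apply: cvgD; first exact: cvg_cst.
    by apply: cvgM; [apply: cvgM; exact: cvg_id|exact: cvg_cst].
  by rewrite !mul0r addr0 in cv; exact: cvgr_lt cv _ H_lt0.
(* The punctured neighborhood provides [t != 0], so that [t ^ 2] is positive in the final
   contradiction. *)
have /filter_ex[t [t0 [fp [fm neg]]]] : \forall t \near (0 : R)^',
    t != 0 /\ (full_col_rank n r (Y + t *: xi) /\
    (full_col_rank n r (Y - t *: xi) /\ hessian A B C Y xi xi + t ^+ 2 * c < 0)).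
  near=> t; split; first by near: t; exact: nbhs_dnbhs_neq.
  split; first by rewrite -[xi]scale1r; near: t; exact: cvg_within (nf 1).
  split; last by near: t; exact: cvg_within nneg.
  rewrite -scalerN -[- xi]scaleN1r; near: t; exact: cvg_within (nf (-1)).
have := lagrangian_second_difference C AT BT Y xi t.
have := minY _ (psd_rank_gram fp); have := minY _ (psd_rank_gram fm).
rewrite !cost_gram -/c => le1 le2 eq12.
have : 0 <= t ^+ 2 * (hessian A B C Y xi xi + t ^+ 2 * c) by nra.
by rewrite pmulr_rge0 ?leNgt ?neg// exprn_even_gt0.
Unshelve. all: by end_near. Qed.

End MetricProperties.

Lemma full_rank_quotientP (R : realType) n r (Y : 'M[R]_(n, r)) :
  full_col_rank n r Y <-> total_over full_rank_quotient Y.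
Proof. by split=> [fY|[]//]; split=> //; exists Y. Qed.

Theorem proposition5p2 (R : realType) (n r : nat) (A B C : 'M[R]_n)
    (hA : spd A) (hB : spd B) (hC : C^T = C) :
  [/\ (* near the minimum, for every omega in [0, 1[ *)
      forall Ymin : 'M[R]_(n, r),
        full_col_rank n r Ymin -> is_minimizer r A B C (Ymin *m Ymin^T) ->
        forall omega : R, 0 <= omega < 1 ->
        exists W : set (set 'M[R]_(n, r)),
          [/\ open_in_quotient W, W (orbit_class Ymin),
              riemannian_metric_on (total_over W) (metric A B C omega)
            & induces_quotient_metric W (metric A B C omega)],
      (* the term without omega as an approximation of L_xx *)
      forall Y : 'M[R]_(n, r), full_col_rank n r Y ->
        [/\ forall xi eta,
              second_derivative (lagrangian A B C) Y xi eta =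
              weighted_form A B C Y xi eta + dominant_form A B Y xi eta,
            forall xi eta, dominant_form A B Y xi eta = dominant_form A B Y eta xi,
            forall xi, xi != 0 -> 0 < dominant_form A B Y xi xi
          & is_minimizer r A B C (Y *m Y^T) ->
            forall xi, - weighted_form A B C Y xi xi <= dominant_form A B Y xi xi]
    & (* omega = 0, globally *)
      [/\ forall Y : 'M[R]_(n, r), full_col_rank n r Y ->
            spd (Y^T *m B *m Y) /\ spd (Y^T *m A *m Y),
          riemannian_metric_on (full_col_rank n r) (metric A B C 0 (r := r))
        & induces_quotient_metric full_rank_quotient (metric A B C 0 (r := r))]].
Proof.
have AT := hA.1; have BT := hB.1.
have mL omega := @metricL R n r A B C hA hB hC omega.
have mC omega := @metricC R n r A B C hA hB hC omega.
have mO omega := @metric_orth R n r A B C hA hB hC omega.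
have mS omega := @metric_smooth R n r A B C hA hB hC omega.
split.
- move=> Ymin fYmin minY omega /andP[omega_ge0 omega_lt1].
  pose pos Y := forall xi : 'M[R]_(n, r), xi != 0 -> 0 < metric A B C omega Y xi xi.
  (* Positivity passes along the orbit, so it is a property of the class and the set [W] below is
     saturated. *)
  have posO Y O : orthogonal_mx O -> pos Y -> pos (Y *m O).
    move=> hO pY xi xi0; have hOT := orthogonal_mxT hO.
    have xiE : xi = xi *m O^T *m O by rewrite -mulmxA (hO : O^T *m O = 1%:M) mulmx1.
    rewrite xiE mO//; apply: pY; apply: contra_neq xi0 => xi0.
    by rewrite xiE xi0 mul0mx.
  pose W := [set orbit_class Y | Y in full_col_rank n r `&` pos].
  have WE : total_over W = full_col_rank n r `&` pos.
    apply/seteqP; split=> Y [fY]; last by move=> pY; split=> //; exists Y.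
    move=> [Y1 [fY1 pY1] YY1]; split=> //.
    have : orbit_class Y Y by exact: orbit_class_refl.
    by rewrite -YY1 => -[ O hO <-]; exact: posO.
  have oW : open_in_quotient W.
    split=> [_ [Y [fY _] <-]|]; first by exists Y.
    rewrite WE openE => Y [fY pY].
    apply: filterI.
      by apply: open_nbhs_nbhs; split=> //; exact: full_col_rank_open.
    have : spd (gram (metric A B C omega Y)).
      by apply/(gram_spd (mL omega Y) (mC omega Y)).
    move=> /(near_spd (G := fun Y => gram (metric A B C omega Y))).
    have cG i j : {for Y, continuous (fun Y => gram (metric A B C omega Y) i j)}.
      apply: (@smooth_on_continuous _ _ setT) => //.
      have -> : (fun Y => gram (metric A B C omega Y) i j) = (fun Y =>
          metric A B C omega Y (vec_mx (delta_mx 0 i)) (vec_mx (delta_mx 0 j))).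
        by apply/funext => Y'; rewrite mxE.
      exact (mS omega _ _ _ openT (smooth_mx_cst _ _) (smooth_mx_cst _ _)).
    move=> /(_ cG (fun Y => gram_sym (mC omega Y))).
    by apply: filterS => Y' /(gram_spd (mL omega Y') (mC omega Y')).
  have posW Y : total_over W Y -> pos Y by rewrite WE => -[].
  have WYmin : W (orbit_class Ymin).
    exists Ymin => //; split=> // xi xi0; rewrite (metricE hA hB hC).
    (* The Hessian part is nonnegative by minimality; strictness comes from the dominant part, whose
       weight [1 - omega] is positive. *)
    apply: ltr_wpDl.
      by rewrite mulr_ge0// (hessian_ge0 hA hB xi fYmin minY).
    by rewrite mulr_gt0 ?subr_gt0// (dominant_gt0 hA hB).
  exists W; split=> //.
    exact: (total_over_metric (mL omega) (mC omega) (mS omega) oW posW).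
  exact: (quotient_metric_induced (mL omega) (mC omega) (mO omega)
      (mS omega) oW posW).
- move=> Y fY; split.
  + by move=> xi eta; rewrite (lagrangian_second_derivative C hA hB)
      (hessianE AT BT hC).
  + by move=> xi eta; exact: dominant_sym.
  + by move=> xi xi0; exact: dominant_gt0.
  (* The difference of the two sides is the Hessian. *)
  + move=> minY xi; rewrite -subr_ge0 opprK addrC (hessianE AT BT hC).
    exact: (hessian_ge0 hA hB).
- have pos0 Y : total_over full_rank_quotient Y -> forall xi : 'M[R]_(n, r),
      xi != 0 -> 0 < metric A B C 0 Y xi xi.
    (* At [omega = 0] only the dominant form remains, and its positivity does not depend on
       minimality. *)
    move=> /full_rank_quotientP fY xi xi0.
    by rewrite (metricE hA hB hC) mul0r add0r subr0 mul1r (dominant_gt0 hA hB).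
  have totE : total_over full_rank_quotient = full_col_rank n r :> set 'M[R]_(n, r).
    by apply/seteqP; split=> Y /full_rank_quotientP.
  have oW : open_in_quotient (full_rank_quotient : set (set 'M[R]_(n, r))).
    by split=> //; rewrite totE; exact: full_col_rank_open.
  split.
  + move=> Y /full_col_rankP/mulVpmx LY.
    have Yinj (v : 'cV_r) : Y *m v = 0 -> v = 0.
      by move=> /(congr1 (mulmx (pinvmx Y))); rewrite mulmxA LY mul1mx mulmx0.
    by split; exact: spd_congr.
  + have := total_over_metric (mL 0) (mC 0) (mS 0) oW pos0.
    by rewrite totE.
  + exact: (quotient_metric_induced (mL 0) (mC 0) (mO 0) (mS 0) oW pos0).
Qed.
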